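(* Let $\hat L$ be the twisted affinization of a minimal Q-graded subalgebra $L$ (of a finite dimensional semisimple Lie algebra $\mathbb{L}$ over $\mathbb{F}$) with $\dim L=2\dim[L,L]$. Then any odd almost inner derivation of $\hat L$ is an inner derivation, and any even almost inner derivation $D$ of $\hat L$ can be written uniquely as an infinite sum $$D=\sum_{i,j}a_{ij}D_{ij}+\mathrm{ad}\,y,\qquad a_{ij}\in\mathbb{F},\ y\in\hat L,$$ where the sum is over $1\le i\le l$, $j\in\mathbb{Z}$, the $D_{ij}$ are the almost inner derivations of $\hat L$ defined, for all $1\le i\le l$ and all $j\in\mathbb{Z}$, by $D_{ij}(K)=0$, $D_{ij}(x_m\otimes t^{2n+1})=0$ and $D_{ij}(h_m\otimes t^{2n})=\delta_{im}\delta_{jn}K$ for $1\le m\le l$, $n\in\mathbb{Z}$, and $y$ is an even element of the $\mathbb{Z}_2$-graded Lie algebra $\hat L$. Moreover, the infinite subset $\{D_{ij}+\mathrm{Inn}(\hat L) : 1\le i\le l,\ j\in\mathbb{Z}\}$ of the quotient space $\mathrm{AID}(\hat L)/\mathrm{Inn}(\hat L)$ is linearly independent.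
   Context: $\mathbb{F}$ is an algebraically closed field of characteristic $0$, $\mathbb{L}$ is a finite dimensional semisimple Lie algebra over $\mathbb{F}$, $H$ is a maximal torus of $\mathbb{L}$, $\Phi$ is the corresponding root system with a base $\{\alpha_1,\dots,\alpha_l\}$, $\mathbb{L}=H\oplus\bigoplus_{\alpha\in\Phi}L_\alpha$ is the root space decomposition, and $Q=\mathbb{Z}\Phi$ is the root lattice. Minimal Q-graded subalgebra: a subalgebra $L$ of $\mathbb{L}$ such that (1) $H\subseteq L$ and there is a subset $\Psi\subseteq\Phi$ with $\mathrm{span}_{\mathbb{Z}}\Psi=Q$ and $L=H\oplus\bigoplus_{\alpha\in\Psi}L_\alpha$; (2) no subalgebra $L_1\subsetneq L$ satisfies (1). Put $I=[L,L]$. When $\dim L=2\dim[L,L]$, $\Psi=\{\beta_1,\dots,\beta_l\}$ is a basis of $H^*$ and $L=H\oplus I$ has a basis $h_1,\dots,h_l,x_1,\dots,x_l$, where $h_1,\dots,h_l$ is the basis of $H$ dual to $\Psi$ (so $\beta_j(h_i)=\delta_{ij}$) and $0\neq x_i\in L_{\beta_i}$, so that $x_1,\dots,x_l$ is a basis of $I$. This basis is fixed. $R=\mathbb{F}[t^2,t^{-2}]$. The twisted affinization is $\hat L=H\otimes R\oplus I\otimes Rt\oplus\mathbb{F}K$, a subalgebra of the affinization $L\otimes\mathbb{F}[t,t^{-1}]\oplus\mathbb{F}K$, whose bracket is $[a\otimes t^m,b\otimes t^n]=[a,b]\otimes t^{m+n}+m\,\delta_{m+n,0}(a,b)K$ with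 $K$ central, $(\cdot,\cdot)$ being the restriction to $L$ of the Killing form of $\mathbb{L}$. It is $\mathbb{Z}_2$-graded by $\hat L_{\bar 0}=H\otimes R\oplus\mathbb{F}K$ (even elements) and $\hat L_{\bar 1}=I\otimes Rt$ (odd elements). A derivation $D$ of $\hat L$ is even if $D(\hat L_k)\subseteq\hat L_k$ for $k=\bar0,\bar1$, and odd if $D(\hat L_k)\subseteq\hat L_{k+\bar1}$ for $k=\bar0,\bar1$. A derivation $D$ of a Lie algebra $\mathcal{L}$ is almost inner if $D(x)\in[x,\mathcal{L}]$ for every $x\in\mathcal{L}$. $\mathrm{AID}(\mathcal L)$ and $\mathrm{Inn}(\mathcal L)$ denote the spaces of almost inner and of inner derivations of $\mathcal{L}$. An infinite sum $\sum a_{ij}D_{ij}$ is understood pointwise (only finitely many terms are nonzero on each element of $\hat L$).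
   Formalization: D_{ij} is shown almost inner only for j≠0, as D_{i0}(h_i⊗1)=K is not in [h_i⊗1, L̂]; so independence of all the D_{ij} is modulo Inn(L̂) among derivations. Uniqueness is of the a_{ij} and of ad y, since y is determined only up to the central 𝔽K. *)

(* Defs.v *)
From HB Require Import structures.
From mathcomp Require Import all_boot all_order all_algebra.
From mathcomp Require Import finmap zify.
From mathcomp.multinomials Require Import monalg.

Set Implicit Arguments.
Unset Strict Implicit.
Unset Printing Implicit Defensive.

Import Order.TTheory GRing.Theory Num.Theory.
Local Open Scope ring_scope.

Reserved Notation "[ 'lie' x , y ]" (format "[ 'lie'  x ,  y ]").

HB.mixin Record Lmodule_isLie (F : fieldType) V of GRing.Lmodule F V := {
  lie : V -> V -> V;
  lie_linearl : forall y, linear (lie^~ y);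
  lie_linearr : forall x, linear (lie x);
  liexx : forall x, lie x x = 0;
  lie_jacobi : forall x y z,
    lie x (lie y z) + lie y (lie z x) + lie z (lie x y) = 0
}.

#[short(type="lieAlgType")]
HB.structure Definition LieAlgebra (F : fieldType) :=
  {V of GRing.Lmodule F V & Lmodule_isLie F V}.

#[short(type="finLieAlgType")]
HB.structure Definition FinLieAlgebra (F : fieldType) :=
  {V of Vector F V & LieAlgebra F V}.

Notation "[ 'lie' x , y ]" := (lie x y) : ring_scope.

Section LieTheory.
Variables (F : fieldType) (g : lieAlgType F).
Implicit Types x y z : g.

HB.instance Definition _ x := GRing.isSemilinear.Build F g g _ (lie x)
  (GRing.semilinear_linear (lie_linearr x)).

Lemma lieDl x1 x2 y : [lie x1 + x2, y] = [lie x1, y] + [lie x2, y].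
Proof. by have := lie_linearl y 1 x1 x2; rewrite !scale1r. Qed.

Lemma lieDr x y1 y2 : [lie x, y1 + y2] = [lie x, y1] + [lie x, y2].
Proof. exact: raddfD. Qed.

Lemma lie0l y : [lie 0, y] = 0.
Proof. by apply: (addIr [lie 0, y]); rewrite -lieDl !add0r. Qed.

Lemma lie0r x : [lie x, 0] = 0.
Proof. exact: raddf0. Qed.

Lemma lieZl c x y : [lie c *: x, y] = c *: [lie x, y].
Proof. by have := lie_linearl y c x 0; rewrite !addr0 lie0l addr0. Qed.

Lemma lieZr c x y : [lie x, c *: y] = c *: [lie x, y].
Proof. exact: linearZ. Qed.

Lemma lieC x y : [lie x, y] = - [lie y, x].
Proof.
have := liexx (x + y); rewrite lieDl !lieDr !liexx add0r addr0.
by move/eqP; rewrite addr_eq0 => /eqP.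
Qed.

Lemma lieNr x y : [lie x, - y] = - [lie x, y].
Proof. exact: raddfN. Qed.

Lemma lieA x y z : [lie x, [lie y, z]] = [lie [lie x, y], z] + [lie y, [lie x, z]].
Proof.
have := lie_jacobi x y z; rewrite -addrA => /eqP; rewrite addr_eq0 => /eqP ->.
by rewrite opprD addrC (lieC z) opprK (lieC z x) lieNr opprK.
Qed.

Definition derivation (D : {linear g -> g}) : Prop :=
  forall x y, D [lie x, y] = [lie D x, y] + [lie x, D y].

Definition inner (D : {linear g -> g}) : Prop := exists y, forall x, D x = [lie y, x].

Definition almost_inner (D : {linear g -> g}) : Prop :=
  derivation D /\ forall x, exists y, D x = [lie x, y].

(* f has finitely many nonzero values, and their sum is v. *)
Definition has_fsum (T : eqType) (f : T -> g) (v : g) : Prop :=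
  exists s : seq T, [/\ uniq s, forall p, p \notin s -> f p = 0
                      & v = \sum_(p <- s) f p].

(* D = \sum_p a p *: E p + ad y, the possibly infinite sum being pointwise. *)
Definition expansion (T : eqType) (E : T -> {linear g -> g}) (a : T -> F) y
    (D : {linear g -> g}) : Prop :=
  forall x, exists2 v, has_fsum (fun p => a p *: E p x) v & D x = v + [lie y, x].

(* The cosets E p + Inn(g) form a linearly independent family. *)
Definition independent_mod_inner (T : eqType) (E : T -> {linear g -> g}) : Prop :=
  forall (s : seq T) (c : T -> F), uniq s ->
    (exists y, forall x, \sum_(p <- s) c p *: E p x = [lie y, x]) ->
    forall p, p \in s -> c p = 0.

End LieTheory.

(* The integral span of a possibly infinite set of vectors. *)
Definition in_Zspan (M : zmodType) (P : {pred M}) (v : M) : Prop :=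
  exists (s : seq M) (c : M -> int), {subset s <= P} /\ v = \sum_(a <- s) a *~ c a.

Section FinLie.
Variables (F : fieldType) (g : finLieAlgType F).
Implicit Types (x y : g) (U V W H L : {vspace g}).

Definition ad x : 'End(g) := linfun (lie x).

Lemma adE x y : ad x y = [lie x, y].
Proof. exact: lfunE. Qed.

Definition lfun_tr (f : 'End(g)) : F :=
  \sum_(i < \dim {:g}) coord (vbasis {:g}) i (f (vbasis {:g})`_i).

Definition killing x y : F := lfun_tr (ad x \o ad y)%VF.

Definition lie_vs U V : {vspace g} :=
  <<[seq [lie x, y] | x <- vbasis U, y <- vbasis V]>>%VS.

Lemma mem_lie_vs U V x y : x \in U -> y \in V -> [lie x, y] \in lie_vs U V.
Proof.
move=> xU yV; rewrite (coord_vbasis xU) (coord_vbasis yV).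
rewrite [X in X \in _](_ : _ = \sum_(i < \dim U) \sum_(j < \dim V)
  coord (vbasis U) i x *: (coord (vbasis V) j y *: [lie (vbasis U)`_i, (vbasis V)`_j])).
  apply: memv_suml => i _; apply: memv_suml => j _; do 2!apply: memvZ.
  by apply: memv_span; apply: allpairs_f; rewrite mem_nth ?size_tuple.
under [RHS]eq_bigr => i _.
  rewrite -scaler_sumr; under eq_bigr => j _ do rewrite -lieZr.
  rewrite -raddf_sum -lieZl; over.
by elim/big_rec2: _ => [|i u v _ <-]; rewrite ?lie0l // lieDl.
Qed.

Lemma lie_vs_sub U V W :
  (forall x y, x \in U -> y \in V -> [lie x, y] \in W) -> (lie_vs U V <= W)%VS.
Proof.
move=> UVW; apply/span_subvP => z /allpairsP[[x y] /= [xU yV ->]].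
by apply: UVW; apply: vbasis_mem.
Qed.

Definition subalgebra U : bool := (lie_vs U U <= U)%VS.
Definition ideal U : bool := (lie_vs fullv U <= U)%VS.

Definition solvable U : Prop :=
  exists n, iter n (fun V => lie_vs V V) U = 0%VS.

Definition semisimple : Prop := forall U, ideal U -> solvable U -> U = 0%VS.

(* Over an algebraically closed field, ad x is semisimple iff it has an
   eigenbasis. *)
Definition ad_semisimple x : Prop :=
  exists2 b : seq g, basis_of fullv b
    & forall v, v \in b -> exists c : F, [lie x, v] = c *: v.

Definition torus H : Prop := subalgebra H /\ (forall x, x \in H -> ad_semisimple x).

Definition maximal_torus H : Prop :=
  torus H /\ (forall H', torus H' -> (H <= H')%VS -> H' = H).

Definition dual H := 'Hom(subvs_of H, F^o).

Definition weight_space H (a : dual H) : {vspace g} :=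
  (\bigcap_(i < \dim {:subvs_of H})
     passmx.leigenspace (ad (vsval (vbasis {:subvs_of H})`_i)) (a (vbasis {:subvs_of H})`_i))%VS.

Lemma weight_spaceP H (a : dual H) x :
  reflect (forall h : subvs_of H, [lie vsval h, x] = (a h : F) *: x) (x \in weight_space a).
Proof.
have eigE y c : (x \in passmx.leigenspace (ad y) c) = ([lie y, x] == c *: x).
  by rewrite memv_ker add_lfunE opp_lfunE scale_lfunE id_lfunE adE subr_eq0.
apply: (iffP idP) => [xW h | xh].
  have xWi (i : 'I_(\dim {:subvs_of H})) : [lie vsval (vbasis {:subvs_of H})`_i, x] =
      (a (vbasis {:subvs_of H})`_i : F) *: x.
    move: xW; rewrite memvE => /subv_bigcapP/(_ i isT).
    by rewrite -memvE eigE => /eqP.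
  rewrite (coord_vbasis (memvf h)).
  elim/big_ind: _ => [|u v IHu IHv|i _].
  - by rewrite !linear0 lie0l scale0r.
  - by rewrite linearD lieDl IHu IHv -scalerDl [a (u + v)]linearD.
  - by rewrite linearZ lieZl xWi scalerA [a (_ *: _)]linearZ.
by rewrite memvE; apply/subv_bigcapP => i _; rewrite -memvE eigE xh.
Qed.

Definition roots H : {pred dual H} :=
  [pred a | (a != 0) && (weight_space a != 0%VS)].

(* L is a subalgebra that is the direct sum of H and of the root spaces indexed
   by a set Psi of roots (enumerated by a duplicate-free list) whose integral
   span is the root lattice. *)
Definition Qgraded_by H L (Psi : seq (dual H)) : Prop :=
  [/\ subalgebra L, (H <= L)%VS, uniq Psi /\ {subset Psi <= @roots H},
      (forall m, in_Zspan (mem Psi) m <-> in_Zspan (@roots H) m)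
    & L = (H + \sum_(a <- Psi) weight_space a)%VS /\
      directv (H + \sum_(a <- Psi) weight_space a)].

Definition Qgraded H L : Prop := exists Psi : seq (dual H), Qgraded_by L Psi.

Definition minimal_Qgraded H L : Prop :=
  Qgraded H L /\ (forall L1, Qgraded H L1 -> (L1 <= L)%VS -> L1 = L).

(* beta enumerates the roots of L, h is the basis of H dual to it, and x i is a
   root vector of [L, L] for beta i. *)
Definition adapted_basis H L (beta : 'I_(\dim H) -> dual H)
    (h : 'I_(\dim H) -> subvs_of H) (x : 'I_(\dim H) -> subvs_of (lie_vs L L)) : Prop :=
  [/\ Qgraded_by L (codom beta),
      forall i j, beta j (h i) = (i == j)%:R
    & forall i, vsval (x i) != 0 /\ vsval (x i) \in weight_space (beta i)].

End FinLie.

Section Killing.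
Variables (F : fieldType) (g : finLieAlgType F).
Implicit Types (x y z : g) (f : 'End(g)).

Lemma lfun_tr_is_linear : scalar (@lfun_tr F g).
Proof.
move=> c f1 f2; rewrite /lfun_tr mulr_sumr -big_split; apply: eq_bigr => i _ /=.
by rewrite add_lfunE scale_lfunE linearP.
Qed.

HB.instance Definition _ := GRing.isSemilinear.Build F 'End(g) F _ (@lfun_tr F g)
  (GRing.semilinear_linear lfun_tr_is_linear).

Lemma lfun_trC f1 f2 : lfun_tr (f1 \o f2)%VF = lfun_tr (f2 \o f1)%VF.
Proof.
have trE (f f' : 'End(g)) : lfun_tr (f \o f')%VF = \sum_(i < \dim {:g}) \sum_(j < \dim {:g})
    coord (vbasis {:g}) j (f' (vbasis {:g})`_i) * coord (vbasis {:g}) i (f (vbasis {:g})`_j).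
  apply: eq_bigr => i _; rewrite comp_lfunE {1}(coord_vbasis (memvf (f' _))).
  by rewrite !linear_sum; apply: eq_bigr => j _; rewrite !linearZ.
rewrite !trE exchange_big; apply: eq_bigr => i _; apply: eq_bigr => j _.
by rewrite mulrC.
Qed.

Lemma adP c x y : ad (c *: x + y) = c *: ad x + ad y.
Proof.
by apply/lfunP => z; rewrite add_lfunE scale_lfunE !adE lieDl lieZl.
Qed.

Lemma ad_lie x y : ad [lie x, y] = (ad x \o ad y)%VF - (ad y \o ad x)%VF.
Proof.
apply/lfunP => z; rewrite add_lfunE opp_lfunE !comp_lfunE !adE (lieA x).
by rewrite addrK.
Qed.

Lemma killing_linearr x : scalar (killing x).
Proof.
by move=> c y1 y2; rewrite /killing adP comp_lfunDr -comp_lfunZr linearP.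
Qed.

Lemma killingC x y : killing x y = killing y x.
Proof. exact: lfun_trC. Qed.

HB.instance Definition _ x := GRing.isSemilinear.Build F g F _ (killing x)
  (GRing.semilinear_linear (killing_linearr x)).

Lemma killing_lie x y z : killing [lie x, y] z = killing x [lie y, z].
Proof.
rewrite /killing !ad_lie comp_lfunDl comp_lfunDr comp_lfunNl comp_lfunNr !linearB /=.
by rewrite !comp_lfunA; congr (_ - _); rewrite -!comp_lfunA lfun_trC -!comp_lfunA.
Qed.

End Killing.

(* The loop space g \otimes F[t, t^-1]: finitely supported maps int -> g, where
   << a *g n >> stands for a \otimes t^n. *)
Definition loop (F : fieldType) (g : finLieAlgType F) : Type := {malg g[int]}.

Section Loop.
Variables (F : fieldType) (g : finLieAlgType F).
Implicit Types (f : loop g) (c : F).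

HB.instance Definition _ := GRing.Zmodule.copy (loop g) {malg g[int]}.

Definition loop_scale c f : loop g := [malg n in msupp f => c *: f@_n].

Lemma loop_scaleE c f n : (loop_scale c f)@_n = c *: f@_n.
Proof. by rewrite mcoeffE; case: msuppP => //; rewrite scaler0. Qed.

Fact loop_scaleA c d f : loop_scale c (loop_scale d f) = loop_scale (c * d) f.
Proof. by apply/malgP => n; rewrite !loop_scaleE scalerA. Qed.
Fact loop_scale1 f : loop_scale 1 f = f.
Proof. by apply/malgP => n; rewrite loop_scaleE scale1r. Qed.
Fact loop_scaleDr c : {morph loop_scale c : f1 f2 / f1 + f2}.
Proof. by move=> f1 f2; apply/malgP => n; rewrite mcoeffD !loop_scaleE mcoeffD scalerDr. Qed.
Fact loop_scaleDl f : {morph loop_scale^~ f : c d / c + d}.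
Proof. by move=> c d; apply/malgP => n; rewrite mcoeffD !loop_scaleE scalerDl. Qed.

HB.instance Definition _ := GRing.Zmodule_isLmodule.Build F (loop g)
  loop_scaleA loop_scale1 loop_scaleDr loop_scaleDl.

Lemma loopZE c f n : (c *: f)@_n = c *: f@_n.
Proof. exact: loop_scaleE. Qed.

End Loop.

Definition affine (F : fieldType) (g : finLieAlgType F) : Type := (loop g * F^o)%type.

HB.instance Definition _ (F : fieldType) (g : finLieAlgType F) :=
  GRing.Lmodule.copy (affine g) (loop g * F^o)%type.

Section Affine.
Variables (F : fieldType) (g : finLieAlgType F).
Implicit Types (a b : g) (m n : int) (u v w : affine g).

(* [a \otimes t^m, b \otimes t^n] *)
Definition aff_lie_mono a m b n : affine g :=
  (<< [lie a, b] *g (m + n)%R >>, if m + n == 0 then m%:~R * killing a b else 0).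

(* Bilinear extension, the second component (the coefficient of K) being central. *)
Definition aff_lie u v : affine g :=
  \sum_(m <- msupp u.1) \sum_(n <- msupp v.1) aff_lie_mono u.1@_m m v.1@_n n.

Definition aff_mono a n : affine g := (<< a *g n >>, 0).

Lemma aff_lie_monoZDr a m c b1 b2 n :
  aff_lie_mono a m (c *: b1 + b2) n = c *: aff_lie_mono a m b1 n + aff_lie_mono a m b2 n.
Proof.
congr pair => /=.
  apply/malgP => k; rewrite mcoeffD loopZE !mcoeffU lieDr lieZr.
  by case: eqP => _; rewrite /= ?mulr1n // !mulr0n scaler0 addr0.
by case: eqP => _; [rewrite linearP mulrDr mulrCA | rewrite scaler0 addr0].
Qed.

Lemma aff_lie_mono0r a m n : aff_lie_mono a m 0 n = 0.
Proof.
have := aff_lie_monoZDr a m (-1) 0 0 n.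
by rewrite scaleN1r oppr0 addr0 => ->; rewrite scaleN1r addNr.
Qed.

Lemma aff_lie_monoC a m b n : aff_lie_mono a m b n = - aff_lie_mono b n a m.
Proof.
congr pair => /=.
  by rewrite lieC monalgUN addrC.
rewrite [n + m]addrC; case: eqP => [mn0 | _]; last by rewrite oppr0.
by rewrite killingC -mulNr -mulrNz; congr (_%:~R * _); apply/eqP; rewrite -addr_eq0 mn0.
Qed.

Lemma aff_lie_mono0l m b n : aff_lie_mono 0 m b n = 0.
Proof. by rewrite aff_lie_monoC aff_lie_mono0r oppr0. Qed.

Lemma aff_lieEw (d1 d2 : {fset int}) u v :
  (msupp u.1 `<=` d1)%fset -> (msupp v.1 `<=` d2)%fset ->
  aff_lie u v = \sum_(m <- d1) \sum_(n <- d2) aff_lie_mono u.1@_m m v.1@_n n.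
Proof.
move=> sd1 sd2; rewrite /aff_lie (big_fset_incl _ sd1) /=; last first.
  by move=> m _ /mcoeff_outdom ->; apply: big1 => n _; rewrite aff_lie_mono0l.
apply: eq_bigr => m _; apply: big_fset_incl => // n _ /mcoeff_outdom ->.
exact: aff_lie_mono0r.
Qed.

Lemma aff_lie_linearr u : linear (aff_lie u).
Proof.
move=> c v1 v2; set v := c *: v1 + v2.
pose d := (msupp v1.1 `|` msupp v2.1 `|` msupp v.1)%fset.
have s0 := fsubset_refl (msupp u.1).
have s1 : (msupp v1.1 `<=` d)%fset by rewrite /d -fsetUA fsubsetUl.
have s2 : (msupp v2.1 `<=` d)%fset by rewrite /d fsetUAC fsubsetUr.
have s3 : (msupp v.1 `<=` d)%fset by rewrite /d fsubsetUr.
rewrite (aff_lieEw s0 s1) (aff_lieEw s0 s2) (aff_lieEw s0 s3).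
rewrite scaler_sumr -big_split; apply: eq_bigr => m _ /=.
rewrite scaler_sumr -big_split; apply: eq_bigr => n _ /=.
by rewrite -aff_lie_monoZDr /v /= mcoeffD loopZE.
Qed.

Lemma aff_lieC u v : aff_lie u v = - aff_lie v u.
Proof.
rewrite /aff_lie exchange_big -sumrN; apply: eq_bigr => m _.
by rewrite -sumrN; apply: eq_bigr => n _; rewrite aff_lie_monoC.
Qed.

Lemma aff_lie_linearl v : linear (aff_lie^~ v).
Proof.
move=> c u1 u2; rewrite /= aff_lieC aff_lie_linearr opprD -scalerN.
by rewrite -!(aff_lieC _ v).
Qed.

HB.instance Definition _ u := GRing.isSemilinear.Build F (affine g) (affine g) _
  (aff_lie u) (GRing.semilinear_linear (aff_lie_linearr u)).

Lemma aff_lieDl u1 u2 v : aff_lie (u1 + u2) v = aff_lie u1 v + aff_lie u2 v.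
Proof. by have := aff_lie_linearl v 1 u1 u2; rewrite /= !scale1r. Qed.

Lemma aff_lieDr u v1 v2 : aff_lie u (v1 + v2) = aff_lie u v1 + aff_lie u v2.
Proof. exact: raddfD. Qed.

Lemma aff_lie_monoE a m b n c d :
  aff_lie (<< a *g m >>, c) (<< b *g n >>, d) = aff_lie_mono a m b n.
Proof.
by rewrite (@aff_lieEw [fset m]%fset [fset n]%fset) ?msuppU_le //
           !big_seq_fset1 /= !mcoeffUU.
Qed.

Lemma aff_ind (P : affine g -> Prop) :
  (forall c, P (0, c)) -> (forall u v, P u -> P v -> P (u + v)) ->
  (forall a n, P (aff_mono a n)) -> forall u, P u.
Proof.
move=> P0 addP Pm [f c].
have -> : (f, c) = (0, c) + (f, 0) :> affine g by congr pair; rewrite /= ?add0r ?addr0.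
apply: (addP) => //; rewrite (monalgE f).
elim: (enum_fset _) => [|k s IHs]; first by rewrite big_nil.
rewrite big_cons; set r := \sum_(_ <- _) _.
have -> : (<< f@_k *g k >> + r, 0) = aff_mono f@_k k + (r, 0) :> affine g.
  by congr pair; rewrite /= addr0.
exact: addP.
Qed.

Lemma aff_lie0l c v : aff_lie (0, c) v = 0.
Proof. by rewrite /aff_lie /= msupp0 big_seq_fset0. Qed.

Lemma aff_liexx u : aff_lie u u = 0.
Proof.
elim/aff_ind: u => [c | u v uu vv | a n]; first exact: aff_lie0l.
  by rewrite aff_lieDl !aff_lieDr uu vv add0r addr0 [aff_lie u v]aff_lieC addNr.
rewrite /aff_mono aff_lie_monoE /aff_lie_mono liexx monalgU0.
congr pair; case: eqP => // /eqP; rewrite -mulr2n mulrn_eq0 /= => /eqP ->.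
by rewrite mul0r.
Qed.

Lemma aff_jacobi u v w :
  aff_lie u (aff_lie v w) + aff_lie v (aff_lie w u) + aff_lie w (aff_lie u v) = 0.
Proof.
pose J u v w :=
  aff_lie u (aff_lie v w) + aff_lie v (aff_lie w u) + aff_lie w (aff_lie u v).
have Jrot u' v' w' : J u' v' w' = J v' w' u' by rewrite /J -addrA addrC.
have JD u1 u2 v' w' : J (u1 + u2) v' w' = J u1 v' w' + J u2 v' w'.
  rewrite /J aff_lieDl [aff_lie w' (u1 + u2)]aff_lieDr [aff_lie (u1 + u2) v']aff_lieDl.
  by rewrite !aff_lieDr [X in X + _ = _]addrACA [LHS]addrACA.
have l0 c v' : aff_lie v' (0, c) = 0 by rewrite aff_lieC aff_lie0l oppr0.
have l00 v' : aff_lie v' 0 = 0 := l0 0 v'.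
have J0 c v' w' : J (0, c) v' w' = 0.
  by rewrite /J !l0 !aff_lie0l !l00 !addr0.
rewrite -/(J u v w).
elim/aff_ind: u => [c | u1 u2 h1 h2 | a m]; [exact: J0 | by rewrite JD h1 h2 addr0 |].
rewrite Jrot; elim/aff_ind: v => [c | u1 u2 h1 h2 | b n]; [exact: J0 | by rewrite JD h1 h2 addr0 |].
rewrite Jrot; elim/aff_ind: w => [c | u1 u2 h1 h2 | d p]; [exact: J0 | by rewrite JD h1 h2 addr0 |].
rewrite /J /aff_mono !aff_lie_monoE /aff_lie_mono.
have -> : m + (n + p) = p + (m + n) by rewrite addrA addrC.
have -> : n + (p + m) = p + (m + n) by rewrite addrCA [n + m]addrC.
congr pair => /=.
  by rewrite -!monalgUD lie_jacobi monalgU0.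
case: eqP => [pmn0 | _]; last by rewrite !addr0.
have -> : killing b [lie d, a] = killing a [lie b, d] by rewrite -killing_lie killingC.
have -> : killing d [lie a, b] = killing a [lie b, d] by rewrite killingC killing_lie.
by rewrite -!mulrDl -!intrD -addrA pmn0 mul0r.
Qed.

End Affine.

HB.instance Definition _ (F : fieldType) (g : finLieAlgType F) :=
  @Lmodule_isLie.Build F (affine g) (@aff_lie F g) (@aff_lie_linearl F g)
    (@aff_lie_linearr F g) (@aff_liexx F g) (@aff_jacobi F g).

Section Twisted.
Variables (F : fieldType) (g : finLieAlgType F).
Implicit Types (H I L : {vspace g}) (u v : affine g).

(* The conditions under which twisted_pred below is a subalgebra of affine g. *)
Definition twistable H I : Prop :=
  [/\ (lie_vs H H <= H)%VS, (lie_vs H I <= I)%VS & (lie_vs I I <= H)%VS].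

Definition parity_part H I (n : int) : {vspace g} := if odd `|n|%N then I else H.

(* H \otimes F[t^2, t^-2] + I \otimes F[t^2, t^-2] t + F K *)
Definition twisted_pred H I : {pred affine g} :=
  [pred u | all (fun n => u.1@_n \in parity_part H I n) (msupp u.1)].

Lemma twisted_predP H I u :
  reflect (forall n, u.1@_n \in parity_part H I n) (u \in twisted_pred H I).
Proof.
apply: (iffP allP) => [uP n | uP n _]; last exact: uP.
by have [/uP // | _] := msuppP; rewrite mem0v.
Qed.

Fact twisted_submod_closed H I : submod_closed (twisted_pred H I).
Proof.
split=> [|c u v /twisted_predP uP /twisted_predP vP]; apply/twisted_predP => n.
  by rewrite mcoeff0 mem0v.
by rewrite mcoeffD loopZE memvD ?memvZ.
Qed.

HB.instance Definition _ H I := GRing.isSubmodClosed.Build F (affine g)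
  (twisted_pred H I) (twisted_submod_closed H I).

Lemma parity_part_lie H I m n a b : twistable H I ->
  a \in parity_part H I m -> b \in parity_part H I n ->
  [lie a, b] \in parity_part H I (m + n).
Proof.
case=> HH HI II; rewrite /parity_part.
have -> : odd `|(m + n)%R|%N = odd `|m|%N (+) odd `|n|%N by lia.
case: odd; case: odd => /= aP bP.
- exact: subvP II _ (mem_lie_vs aP bP).
- by rewrite lieC memvN; apply: subvP HI _ (mem_lie_vs bP aP).
- exact: subvP HI _ (mem_lie_vs aP bP).
- exact: subvP HH _ (mem_lie_vs aP bP).
Qed.

Lemma twisted_lie_closed H I u v : twistable H I ->
  u \in twisted_pred H I -> v \in twisted_pred H I -> [lie u, v] \in twisted_pred H I.
Proof.
move=> HI /twisted_predP uP /twisted_predP vP; apply: rpred_sum => m _.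
apply: rpred_sum => n _; apply/twisted_predP => k; rewrite mcoeffU.
case: eqP => [<- | _]; last by rewrite mem0v.
exact: parity_part_lie.
Qed.

Record twisted H I (HI : twistable H I) := Twisted {
  tw_val : affine g;
  tw_valP : tw_val \in twisted_pred H I
}.

End Twisted.

Section TwistedLie.
Variables (F : fieldType) (g : finLieAlgType F) (H I : {vspace g}) (HI : twistable H I).
Local Notation Lhat := (twisted HI).

HB.instance Definition _ := [isSub for @tw_val F g H I HI].
HB.instance Definition _ := [Choice of Lhat by <:].
HB.instance Definition _ := [SubChoice_isSubLmodule of Lhat by <:].

Definition tw_lie (u v : Lhat) : Lhat :=
  Twisted HI (twisted_lie_closed HI (tw_valP u) (tw_valP v)).

Fact tw_lie_linearl v : linear (tw_lie^~ v).
Proof. by move=> c u1 u2; apply/val_inj; apply: (lie_linearl (tw_val v)). Qed.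
Fact tw_lie_linearr u : linear (tw_lie u).
Proof. by move=> c v1 v2; apply/val_inj; apply: (lie_linearr (tw_val u)). Qed.
Fact tw_liexx u : tw_lie u u = 0.
Proof. by apply/val_inj; apply: (liexx (tw_val u)). Qed.
Fact tw_jacobi u v w :
  tw_lie u (tw_lie v w) + tw_lie v (tw_lie w u) + tw_lie w (tw_lie u v) = 0.
Proof. by apply/val_inj; apply: (lie_jacobi (tw_val u)). Qed.

HB.instance Definition _ := Lmodule_isLie.Build F Lhat
  tw_lie_linearl tw_lie_linearr tw_liexx tw_jacobi.

Fact tw_K_subproof : ((0, 1) : affine g) \in twisted_pred H I.
Proof. by apply/twisted_predP => n; rewrite mcoeff0 mem0v. Qed.
Definition tw_K : Lhat := Twisted HI tw_K_subproof.

Fact tw_even_subproof (a : subvs_of H) n :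
  aff_mono (vsval a) (n *+ 2) \in twisted_pred H I.
Proof.
apply/twisted_predP => k; rewrite mcoeffU; case: eqP => [<-|_]; last exact: mem0v.
by rewrite /parity_part (_ : odd _ = false) ?subvsP //; lia.
Qed.
(* a \otimes t^(2n) *)
Definition tw_even (a : subvs_of H) n : Lhat := Twisted HI (tw_even_subproof a n).

Fact tw_odd_subproof (a : subvs_of I) n :
  aff_mono (vsval a) (n *+ 2 + 1) \in twisted_pred H I.
Proof.
apply/twisted_predP => k; rewrite mcoeffU; case: eqP => [<-|_]; last exact: mem0v.
by rewrite /parity_part (_ : odd _ = true) ?subvsP //; lia.
Qed.
(* a \otimes t^(2n+1) *)
Definition tw_odd (a : subvs_of I) n : Lhat := Twisted HI (tw_odd_subproof a n).

Definition even_part : {pred Lhat} :=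
  [pred u : Lhat | all (fun n : int => ~~ odd `|n|%N) (msupp (tw_val u).1)].
Definition odd_part : {pred Lhat} :=
  [pred u : Lhat | all (fun n : int => odd `|n|%N) (msupp (tw_val u).1) && ((tw_val u).2 == 0)].

Definition even_map (D : {linear Lhat -> Lhat}) : Prop :=
  {homo D : u / u \in even_part} /\ {homo D : u / u \in odd_part}.

Definition odd_map (D : {linear Lhat -> Lhat}) : Prop :=
  (forall u, u \in even_part -> D u \in odd_part) /\
  (forall u, u \in odd_part -> D u \in even_part).

Definition Dij_spec (h : 'I_(\dim H) -> subvs_of H) (x : 'I_(\dim H) -> subvs_of I)
    (i : 'I_(\dim H)) (j : int) (D : {linear Lhat -> Lhat}) : Prop :=
  [/\ D tw_K = 0, forall m n, D (tw_odd (x m) n) = 0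
    & forall m n, D (tw_even (h m) n) = ((i == m)%:R * (j == n)%:R) *: tw_K].

(* A linear map satisfying Dij_spec, see coef_map_spec. *)
Definition coef_map (b : dual H) (j : int) (u : Lhat) : Lhat :=
  (b (vsproj H (tw_val u).1@_(j *+ 2)) : F) *: tw_K.

Fact coef_map_is_linear b j : linear (coef_map b j).
Proof.
by move=> c u v; rewrite /coef_map /= mcoeffD loopZE !linearP scalerDl scalerA.
Qed.

HB.instance Definition _ b j := GRing.isSemilinear.Build F Lhat Lhat _
  (coef_map b j) (GRing.semilinear_linear (coef_map_is_linear b j)).

Lemma coef_map_spec (beta : 'I_(\dim H) -> dual H) h x i j :
  (forall i j, beta j (h i) = (i == j)%:R) -> Dij_spec h x i j (coef_map (beta i) j).
Proof.
move=> dual_h; split=> [|m n|m n]; rewrite /= /coef_map /=.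
- by rewrite mcoeff0 !linear0 scale0r.
- rewrite mcoeffU (_ : _ == _ = false) ?linear0 ?scale0r //; lia.
- rewrite mcoeffU (_ : _ == _ = (j == n)); last lia.
  case: eqP => _; last by rewrite !linear0 mulr0.
  by rewrite vsvalK dual_h eq_sym mulr1.
Qed.

(* The K-component m (a, b) of [a \otimes t^m, b \otimes t^-m] vanishes for m = 0, so
   that D_i0 maps h_i \otimes 1 to K, which is not in [h_i \otimes 1, Lhat]. *)
Lemma Di0_not_almost_inner h x i D : Dij_spec h x i 0 D -> ~ almost_inner D.
Proof.
case=> _ _ Dh [_ /(_ (tw_even (h i) 0))[u]]; rewrite Dh !eqxx mulr1 scale1r.
move=> /(congr1 (fun w => (tw_val w).2)) /= /esym/eqP; apply/negP.
rewrite [X in X.2](_ : _ = aff_lie (aff_mono (vsval (h i)) 0) (tw_val u)); last by rewrite mul0rn.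
suff -> : (aff_lie (aff_mono (vsval (h i)) 0) (tw_val u)).2 = 0 by rewrite eq_sym oner_neq0.
elim/aff_ind: (tw_val u) => [c | v w v0 w0 | a n].
- by rewrite aff_lieC aff_lie0l oppr0.
- by rewrite aff_lieDr /= v0 w0 addr0.
- by rewrite aff_lie_monoE /= mul0r if_same.
Qed.

End TwistedLie.

Arguments even_part {F g H I HI}.
Arguments odd_part {F g H I HI}.

Section AdaptedTwistable.
Variables (F : fieldType) (g : finLieAlgType F) (H L : {vspace g}).
Variables (beta : 'I_(\dim H) -> dual H) (h : 'I_(\dim H) -> subvs_of H).
Variable x : 'I_(\dim H) -> subvs_of (lie_vs L L).

Lemma adapted_twistable : [pchar F] =i pred0 -> torus H -> adapted_basis beta h x ->
  twistable H (lie_vs L L).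
Proof.
move=> F0 [HH _] [[LL HL _ _ [defL _]] dual_h _].
have two0 : 2 != 0 :> F by rewrite ((pcharf0P F).1 F0 2).
pose W i := weight_space (beta i); pose V := (\sum_i W i)%VS.
have {}defL : L = (H + V)%VS.
  by rewrite defL /codom /image_mem big_map big_enum.
have actW (k : subvs_of H) i y : y \in W i -> [lie vsval k, y] = (beta i k : F) *: y.
  by move/weight_spaceP.
pose s := \sum_i h i.
have beta_s i : beta i s = 1 :> F.
  rewrite /s linear_sum (bigD1 i) //= dual_h eqxx big1 ?addr0 // => j /negPf ji.
  by rewrite dual_h ji.
have actV y : y \in V -> [lie vsval s, y] = y.
  case/memv_sumP => ys ysW ->; rewrite raddf_sum; apply: eq_bigr => i _ /=.
  by rewrite (actW _ i) ?beta_s ?scale1r ?ysW.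
have VV y z : y \in V -> z \in V -> y \in L -> z \in L -> [lie y, z] \in lie_vs H H.
  move=> yV zV yL zL.
  have : [lie y, z] \in L by apply: subvP LL _ (mem_lie_vs yL zL).
  have s_yz : [lie vsval s, [lie y, z]] = 2 *: [lie y, z].
    by rewrite lieA !actV // scaler_nat mulr2n.
  rewrite {1}defL => /memv_addP[k kH [v vV def_yz]].
  have yzH : [lie y, z] \in H.
    have -> : [lie y, z] = [lie vsval s, k] - k.
      apply: (addrI [lie y, z]); rewrite -mulr2n -scaler_nat -s_yz def_yz lieDr (actV v) //.
      by rewrite [RHS]addrC addrA subrK.
    by rewrite memvB //; apply: subvP HH _ (mem_lie_vs _ kH); apply: subvsP.
  rewrite -[[lie y, z]](scalerK two0) -s_yz memvZ // mem_lie_vs //.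
  exact: subvsP.
have HV k y : k \in H -> y \in V -> [lie k, y] \in V.
  move=> kH /memv_sumP[ys ysW ->]; rewrite raddf_sum; apply: memv_suml => i _ /=.
  have := actW (vsproj H k) i (ys i); rewrite vsprojK // => -> //; last exact: ysW.
  have /subvP WV : (W i <= V)%VS by apply: (sumv_sup i).
  by rewrite memvZ // WV ?ysW.
have HHV z y : z \in lie_vs H H -> y \in V -> [lie z, y] = 0.
  move=> zHH /memv_sumP[ys ysW ->]; rewrite raddf_sum; apply: big1 => i _ /=.
  have /subvP/(_ z zHH) : (lie_vs H H <= lker (ad (ys i)))%VS.
    apply: lie_vs_sub => a b aH bH; rewrite memv_ker adE lieC.
    have actH a' : a' \in H -> exists c : F, [lie a', ys i] = c *: ys i.
      by move=> a'H; exists (beta i (vsproj H a') : F); rewrite -actW ?ysW ?vsprojK.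
    have [[c ca] [d db]] := (actH a aH, actH b bH).
    have := lieA a b (ys i); rewrite db ca !lieZr db ca !scalerA mulrC => /eqP.
    by rewrite -subr_eq subrr => /eqP <-; rewrite oppr0.
  by rewrite memv_ker adE lieC oppr_eq0 => /eqP.
have /subvP VL : (V <= L)%VS by rewrite defL addvSr.
have /subvP HHs := HH.
have addHV a b : a \in lie_vs H H -> b \in V -> a + b \in (lie_vs H H + V)%VS.
  exact: memv_add.
have subI : (lie_vs L L <= lie_vs H H + V)%VS.
  apply: lie_vs_sub => y z; rewrite {1 2}defL => /memv_addP[k kH [v vV ->]].
  case/memv_addP => k' k'H [v' v'V ->]; rewrite lieDl !lieDr.
  rewrite [X in _ + X]addrC addrACA; apply: addHV.
    by apply: memvD; [exact: mem_lie_vs | apply: VV => //; exact: VL].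
  by apply: memvD; [exact: HV | rewrite lieC memvN; exact: HV].
split=> //.
  by apply: lie_vs_sub => k y kH yI; apply: mem_lie_vs; [apply: subvP HL _ kH|
    apply: subvP yI; apply: lie_vs_sub => u v uL vL; apply: subvP LL _ (mem_lie_vs uL vL)].
apply: lie_vs_sub => y z /(subvP subI)/memv_addP[k kH [v vV ->]].
case/(subvP subI)/memv_addP => k' k'H [v' v'V ->]; rewrite lieDl !lieDr.
rewrite (HHV k v') // addr0 [[lie v, k']]lieC (HHV k' v) // oppr0 add0r.
by apply/HHs/memvD; [apply: mem_lie_vs; apply: HHs | apply: VV => //; apply: VL].
Qed.
End AdaptedTwistable.

(* Main.v *)
(* Write h_i t^(2n) and x_i t^(2n+1) for the adapted basis: all brackets vanish
   except [h_i t^m, x_i t^n] = x_i t^(m+n) and the central terms of the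
   [h_i t^m, h_k t^(-m)].  Evaluating the derivation rule on [h_i t^(2n), h_i] and
   on [h_i t^(2n), x_i t] shows that an odd, resp. even, almost inner derivation
   agrees with an inner one up to a map sending h_i t^(2n) to multiples of K.
   Such a map D_ij, j <> 0, is almost inner since for u with t-components
   A_k (along h_k) and B_k (along x_k), every y = A_m P h_m + B_m P x_m satisfies
   [u, y] in F K, and P can be chosen with [u, y] <> 0 as soon as A_m <> 0 and
   sum_k (h_m, h_k) A_k' <> 0.  Such an m exists because the Gram matrix of the h_i
   is N N^T for an integer matrix N of full row rank (the values of the roots on
   the h_i), so that its principal minors do not vanish. *)
From HB Require Import structures.
Require Import Defs.
From mathcomp Require Import all_boot all_order all_algebra.
From mathcomp Require Import finmap zify.
From mathcomp.multinomials Require Import monalg.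

Set Implicit Arguments.
Unset Strict Implicit.
Unset Printing Implicit Defensive.

Import Order.TTheory GRing.Theory Num.Theory.
Local Open Scope ring_scope.

(** * Coefficients of brackets in the affinization *)

Section AffineCoef.
Variables (F : fieldType) (g : finLieAlgType F).
Implicit Types (a : g) (n p : int) (v : affine g).

Lemma mcoeff_aff_lie a n v p :
  (aff_lie (aff_mono a n) v).1@_p = [lie a, v.1@_(p - n)].
Proof.
elim/aff_ind: v => [c | v w vE wE | b q].
- by rewrite aff_lieC aff_lie0l oppr0 /= !mcoeff0 lie0r.
- by rewrite aff_lieDr /= !mcoeffD vE wE lieDr.
- rewrite aff_lie_monoE /= !mcoeffU (_ : (n + q == p) = (q == p - n)); last lia.
  by case: eqP => _; rewrite ?mulr1n // lie0r.
Qed.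

Lemma aff_lie_central a n v :
  (aff_lie (aff_mono a n) v).2 = n%:~R * killing a v.1@_(- n).
Proof.
elim/aff_ind: v => [c | v w vE wE | b q].
- by rewrite aff_lieC aff_lie0l oppr0 /= !mcoeff0 linear0 mulr0.
- by rewrite aff_lieDr /= !mcoeffD vE wE linearD mulrDr.
- rewrite aff_lie_monoE /= mcoeffU (_ : (n + q == 0) = (q == - n)); last lia.
  by case: eqP => _; rewrite ?mulr1n // linear0 mulr0.
Qed.

End AffineCoef.

(* N is the sum of the last indices of the two supports. *)
Lemma conv_top (R : idomainType) (s : seq int) (f a : int -> R) :
  uniq s -> (exists2 n, n \in s & f n != 0) -> (exists2 n, n \in s & a n != 0) ->
  exists N : int, \sum_(r <- s) \sum_(q <- s) (r + q == N)%:R * (f r * a q) != 0.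
Proof.
move=> s_uniq [n1 n1s fn1] [n2 n2s an2].
have top (b : int -> R) n : n \in s -> b n != 0 ->
    exists k, [/\ k \in s, b k != 0 & forall m, m \in s -> k < m -> b m = 0].
  elim: s {s_uniq n1s n2s} n => [//|k s IHs] n ns bn.
  have [/hasP[m ms bm] | /hasPn s0] := boolP (has (fun m => b m != 0) s).
    have [p [ps bp ptop]] := IHs _ ms bm.
    case: (boolP ((b k != 0) && (p < k))) => [/andP[bk pk] | bkp].
      exists k; split; rewrite ?mem_head // => q; rewrite inE => /predU1P[-> | qs].
        by rewrite ltxx.
      by move=> /(lt_trans pk); apply: ptop.
    exists p; split; rewrite ?inE ?ps ?orbT // => q /predU1P[-> | /ptop //] pk.
    by move: bkp; rewrite pk andbT negbK => /eqP.
  move: ns; rewrite inE => /predU1P[nk | /s0]; last by rewrite bn.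
  exists k; split; rewrite ?mem_head -?nk // => q; rewrite inE => /predU1P[-> | /s0].
    by rewrite nk ltxx.
  by rewrite negbK => /eqP.
have [r [rs fr rtop]] := top f n1 n1s fn1; have [q [qs aq qtop]] := top a n2 n2s an2.
exists (r + q); rewrite (bigD1_seq r) //= (bigD1_seq q) //= eqxx mul1r.
rewrite big1_seq => [|p /andP[pq ps]]; last by rewrite (_ : _ == _ = false) ?mul0r //; lia.
rewrite big1_seq => [|p /andP[pr ps]]; first by rewrite !addr0 mulf_neq0.
(* If p + t = r + q with p <> r, then p > r or t > q, which is beyond the last nonzero value of [f]
   or of [a]. *)
apply: big1_seq => t /= ts; case: eqP => [ptE|_]; last by rewrite mul0r.
have [rp | pr'] := ltP r p; first by rewrite (rtop p) ?mul0r ?mulr0.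
by rewrite (qtop t) ?mulr0 //; lia.
Qed.

Lemma sum_delta1 (R : pzRingType) (T : eqType) (s : seq T) (f : T -> R) n : uniq s ->
  \sum_(p <- s) f p * (p == n)%:R = if n \in s then f n else 0.
Proof.
move=> s_uniq; case: ifP => [ns | ns].
  rewrite (bigD1_seq n) //= eqxx mulr1 big1 ?addr0 // => p /negPf ->.
  by rewrite mulr0.
rewrite big_seq big1 // => p ps; case: eqP => [pn|_]; last by rewrite mulr0.
by rewrite -pn ps in ns.
Qed.

Lemma sum_delta (R : pzRingType) (S : finType) (T : eqType) (s : seq T) (f : S -> T -> R) k n :
  uniq s ->
  \sum_(p <- s) \sum_i f i p * ((i == k) && (p == n))%:R = if n \in s then f k n else 0.
Proof.
move=> s_uniq; rewrite -sum_delta1 //; apply: eq_bigr => p _.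
by rewrite (bigD1 k) //= eqxx big1 ?addr0 // => i /negPf ->; rewrite mulr0.
Qed.

(** The reflection r -> N - r exchanges the two products, but [s] need not be stable under it.
    Writing the second factor as a sum of deltas over [s] gives double sums over [s], in which the
    two indices can be exchanged. *)
Lemma conv_antisym (R : comPzRingType) (s : seq int) (a b : int -> R) (N : int) : uniq s ->
  (forall n, n \notin s -> a n = 0) -> (forall n, n \notin s -> b n = 0) ->
  \sum_(r <- s) (a r * b (N - r) - b r * a (N - r)) = 0.
Proof.
move=> s_uniq a0 b0; have expand (c : int -> R) r : (forall n, n \notin s -> c n = 0) ->
    c r = \sum_(p <- s) c p * (p == r)%:R.
  by move=> c0; rewrite sum_delta1 //; case: ifPn => // /c0.
rewrite sumrB; apply/eqP; rewrite subr_eq0; apply/eqP.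
under eq_bigr => r _ do rewrite (expand b (N - r)) // mulr_sumr.
under [RHS]eq_bigr => r _ do rewrite (expand a (N - r)) // mulr_sumr.
rewrite exchange_big; apply: eq_bigr => p _; apply: eq_bigr => r _.
by rewrite mulrCA (_ : (p == N - r) = (r == N - p)) //; lia.
Qed.

Lemma intr_pchar0 (R : fieldType) (z : int) : [pchar R] =i pred0 -> z != 0 -> z%:~R != 0 :> R.
Proof.
move=> R0; have nat0 n : n != 0%N -> n%:R != 0 :> R by rewrite ((pcharf0P R).1 R0).
case: z => n; first exact: nat0.
by move=> _; rewrite NegzE mulrNz oppr_eq0; apply: nat0.
Qed.

(** * Almost inner derivations of the twisted affinization *)

Section TwistedCoefficients.
Variables (F : fieldType) (F0 : [pchar F] =i pred0) (g : finLieAlgType F).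
Variables (H I : {vspace g}) (HI : twistable H I).
Variables (beta : 'I_(\dim H) -> dual H) (gam : 'I_(\dim H) -> dual I).
Variables (h : 'I_(\dim H) -> subvs_of H) (x : 'I_(\dim H) -> subvs_of I).
Hypothesis dual_h : forall i j, beta j (h i) = (i == j)%:R.
Hypothesis dual_x : forall i j, gam j (x i) = (i == j)%:R.
Hypothesis h_gen : forall a, a = \sum_i (beta i a : F) *: h i.
Hypothesis x_gen : forall a, a = \sum_i (gam i a : F) *: x i.
Hypothesis lie_hh : forall i j, [lie vsval (h i), vsval (h j)] = 0.
Hypothesis lie_hx : forall i j,
  [lie vsval (h i), vsval (x j)] = (i == j)%:R *: vsval (x j).
Hypothesis lie_xx : forall i j, [lie vsval (x i), vsval (x j)] = 0.
Hypothesis kill_xx : forall i j, killing (vsval (x i)) (vsval (x j)) = 0.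

Local Notation Lhat := (twisted HI).
Implicit Types (u v : Lhat) (i j k m : 'I_(\dim H)) (n p q : int).

Definition hmono i n : Lhat := tw_even HI (h i) n.
Definition xmono i n : Lhat := tw_odd HI (x i) n.
Local Notation KK := (tw_K HI).

(** Coordinates in the basis h_k t^(2n), x_k t^(2n+1), K. Membership in [twisted_pred] puts the even
    coefficients in [H] and the odd ones in [I], so that [vsproj] loses nothing. *)
Definition coefh k n u : F := beta k (vsproj H (tw_val u).1@_(n *+ 2)).
Definition coefx k n u : F := gam k (vsproj I (tw_val u).1@_(n *+ 2 + 1)).
Definition coefK u : F := (tw_val u).2.

Lemma coefh_linear k n : scalar (coefh k n).
Proof. by move=> c u v; rewrite /coefh /= mcoeffD loopZE !linearP. Qed.
Lemma coefx_linear k n : scalar (coefx k n).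
Proof. by move=> c u v; rewrite /coefx /= mcoeffD loopZE !linearP. Qed.
Lemma coefK_linear : scalar coefK.
Proof. by []. Qed.

HB.instance Definition _ k n := GRing.isSemilinear.Build F Lhat F _
  (coefh k n) (GRing.semilinear_linear (coefh_linear k n)).
HB.instance Definition _ k n := GRing.isSemilinear.Build F Lhat F _
  (coefx k n) (GRing.semilinear_linear (coefx_linear k n)).
HB.instance Definition _ := GRing.isSemilinear.Build F Lhat F _
  coefK (GRing.semilinear_linear coefK_linear).

Lemma even_coefE u n : (tw_val u).1@_(n *+ 2) = \sum_k coefh k n u *: vsval (h k).
Proof.
have /twisted_predP/(_ (n *+ 2)) := tw_valP u.
rewrite /parity_part (_ : odd _ = false) => [uH|]; last by lia.
rewrite -[LHS](vsprojK uH) {1}(h_gen (vsproj H _)) linear_sum.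
by apply: eq_bigr => k _; rewrite linearZ.
Qed.

Lemma odd_coefE u n : (tw_val u).1@_(n *+ 2 + 1) = \sum_k coefx k n u *: vsval (x k).
Proof.
have /twisted_predP/(_ (n *+ 2 + 1)) := tw_valP u.
rewrite /parity_part (_ : odd _ = true) => [uI|]; last by lia.
rewrite -[LHS](vsprojK uI) {1}(x_gen (vsproj I _)) linear_sum.
by apply: eq_bigr => k _; rewrite linearZ.
Qed.

Lemma int_parity n : exists p, n = p *+ 2 \/ n = p *+ 2 + 1.
Proof. by exists (n %/ 2)%Z; lia. Qed.

Lemma coord_inj u v : (forall k n, coefh k n u = coefh k n v) ->
  (forall k n, coefx k n u = coefx k n v) -> coefK u = coefK v -> u = v.
Proof.
move=> eA eB eK; apply/val_inj/eqP/andP; split; last by apply/eqP.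
apply/eqP/malgP => n; have [p [-> | ->]] := int_parity n.
  by rewrite !even_coefE; apply: eq_bigr => k _; rewrite eA.
by rewrite !odd_coefE; apply: eq_bigr => k _; rewrite eB.
Qed.

Lemma coefh_hmono k n i p : coefh k n (hmono i p) = ((i == k) && (p == n))%:R.
Proof.
rewrite /coefh /= mcoeffU (_ : _ == _ = (p == n)); last lia.
by case: eqP => _; rewrite ?linear0 ?andbF // andbT vsvalK dual_h.
Qed.

Lemma coefh_xmono k n i p : coefh k n (xmono i p) = 0.
Proof. by rewrite /coefh /= mcoeffU (_ : _ == _ = false) ?linear0 //; lia. Qed.

Lemma coefh_K k n : coefh k n KK = 0.
Proof. by rewrite /coefh /= mcoeff0 !linear0. Qed.

Lemma coefx_hmono k n i p : coefx k n (hmono i p) = 0.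
Proof. by rewrite /coefx /= mcoeffU (_ : _ == _ = false) ?linear0 //; lia. Qed.

Lemma coefx_xmono k n i p : coefx k n (xmono i p) = ((i == k) && (p == n))%:R.
Proof.
rewrite /coefx /= mcoeffU (_ : _ == _ = (p == n)); last lia.
by case: eqP => _; rewrite ?linear0 ?andbF // andbT vsvalK dual_x.
Qed.

Lemma coefx_K k n : coefx k n KK = 0.
Proof. by rewrite /coefx /= mcoeff0 !linear0. Qed.

Lemma coefK_hmono i n : coefK (hmono i n) = 0. Proof. by []. Qed.
Lemma coefK_xmono i n : coefK (xmono i n) = 0. Proof. by []. Qed.
Lemma coefK_K : coefK KK = 1. Proof. by []. Qed.

Definition coef_monoE := (coefh_hmono, coefh_xmono, coefh_K,
  coefx_hmono, coefx_xmono, coefx_K, coefK_hmono, coefK_xmono, coefK_K).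

Lemma finite_coord u : exists s : seq int, uniq s /\
  forall n, n \notin s -> forall k, coefh k n u = 0 /\ coefx k n u = 0.
Proof.
(* Floor division by 2 undoes both n -> 2n and n -> 2n + 1, so that one list serves both families of
   coordinates. *)
pose s := undup [seq (n %/ 2)%Z | n <- msupp (tw_val u).1].
exists s; split; first exact: undup_uniq.
move=> n; rewrite mem_undup => ns k; rewrite /coefh /coefx.
rewrite !mcoeff_outdom ?linear0 //; apply: contra ns => /(map_f (fun n => (n %/ 2)%Z)).
  by rewrite (_ : (_ %/ _)%Z = n) //; lia.
by rewrite (_ : (_ %/ _)%Z = n) //; lia.
Qed.

Lemma coord_expand (s : seq int) u : uniq s ->
  (forall n, n \notin s -> forall k, coefh k n u = 0 /\ coefx k n u = 0) ->
  u = \sum_(n <- s) \sum_k (coefh k n u *: hmono k n + coefx k n u *: xmono k n) + coefK u *: KK.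
Proof.
move=> s_uniq s_u.
apply: coord_inj => [k n|k n|]; rewrite linearD linear_sum linearZ /= coef_monoE.
- under eq_bigr => p _ do (rewrite linear_sum; under eq_bigr => i _
    do rewrite linearD !linearZ /= !coef_monoE mulr0 addr0).
  rewrite mulr0 addr0 sum_delta //; case: ifPn => // ns; by case: (s_u n ns k).
- under eq_bigr => p _ do (rewrite linear_sum; under eq_bigr => i _
    do rewrite linearD !linearZ /= !coef_monoE mulr0 add0r).
  rewrite mulr0 addr0 sum_delta //; case: ifPn => // ns; by case: (s_u n ns k).
- under eq_bigr => p _ do (rewrite linear_sum; under eq_bigr => i _
    do rewrite linearD !linearZ /= !coef_monoE !mulr0 addr0).
  by rewrite big1 ?add0r ?mulr1 // => p _; rewrite big1.
Qed.

Lemma coefh_lie_hmono k n i p v : coefh k n [lie hmono i p, v] = 0.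
Proof.
rewrite /coefh /= mcoeff_aff_lie (_ : _ - _ = (n - p) *+ 2); last lia.
rewrite even_coefE linear_sum /= big1 ?linear0 // => m _.
by rewrite linearZ /= lie_hh scaler0.
Qed.

Lemma coefx_lie_hmono k n i p v : coefx k n [lie hmono i p, v] = (i == k)%:R * coefx k (n - p) v.
Proof.
rewrite {1}/coefx /= mcoeff_aff_lie (_ : _ - _ = (n - p) *+ 2 + 1); last lia.
rewrite odd_coefE !linear_sum (bigD1 i) //= big1 => [|m /negPf im]; last first.
  by rewrite linearZ /= lie_hx eq_sym im scale0r scaler0 !linear0.
rewrite addr0 linearZ /= lie_hx eqxx scale1r linearZ /= vsvalK linearZ /= dual_x.
by case: eqP => [->|_]; [rewrite mul1r; exact: mulr1 | rewrite mul0r scaler0].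
Qed.

Lemma coefK_lie_hmono i p v : coefK [lie hmono i p, v] =
  (p *+ 2)%:~R * \sum_k killing (vsval (h i)) (vsval (h k)) * coefh k (- p) v.
Proof.
rewrite /coefK /= aff_lie_central (_ : - _ = (- p) *+ 2); last lia.
rewrite even_coefE linear_sum; congr (_ * _); apply: eq_bigr => k _.
by rewrite linearZ mulrC.
Qed.

Lemma coefh_lie_xmono k n i p v : coefh k n [lie xmono i p, v] = 0.
Proof.
rewrite /coefh /= mcoeff_aff_lie (_ : _ - _ = (n - p - 1) *+ 2 + 1); last lia.
rewrite odd_coefE linear_sum /= big1 ?linear0 // => m _.
by rewrite linearZ /= lie_xx scaler0.
Qed.

Lemma coefx_lie_xmono k n i p v :
  coefx k n [lie xmono i p, v] = - ((i == k)%:R * coefh k (n - p) v).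
Proof.
rewrite {1}/coefx /= mcoeff_aff_lie (_ : _ - _ = (n - p) *+ 2); last lia.
rewrite even_coefE !linear_sum (bigD1 i) //= big1 => [|m /negPf im]; last first.
  by rewrite linearZ /= lieC lie_hx im scale0r oppr0 scaler0 !linear0.
rewrite addr0 linearZ /= lieC lie_hx eqxx scale1r linearZ /= linearN /= vsvalK.
rewrite linearZ linearN /= dual_x scalerN; congr (- _).
by case: eqP => [->|_]; [rewrite mul1r; exact: mulr1 | rewrite mul0r scaler0].
Qed.

Lemma coefK_lie_xmono i p v : coefK [lie xmono i p, v] = 0.
Proof.
(* The degree opposite to 2p + 1 is odd, so only pairings of the x_k occur, and these vanish by
   [kill_xx]. *)
rewrite /coefK /= aff_lie_central (_ : - _ = (- p - 1) *+ 2 + 1); last lia.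
rewrite odd_coefE linear_sum big1 ?mulr0 // => k _.
by rewrite linearZ /= kill_xx mulr0.
Qed.

Lemma lie_K v : [lie KK, v] = 0.
Proof. exact/val_inj/(aff_lie0l 1 (tw_val v)). Qed.

Lemma lie_suml (T : Type) (s : seq T) (f : T -> Lhat) v :
  [lie \sum_(p <- s) f p, v] = \sum_(p <- s) [lie f p, v].
Proof. by elim/big_rec2: _ => [|p w z _ <-]; rewrite ?lie0l // lieDl. Qed.

Lemma coord_ind (P : Lhat -> Prop) :
  (forall c u v, P u -> P v -> P (c *: u + v)) ->
  (forall i n, P (hmono i n)) -> (forall i n, P (xmono i n)) -> P KK -> forall u, P u.
Proof.
move=> linP Ph Px PK u; have [s [s_uniq s_u]] := finite_coord u.
have P0 : P 0 by rewrite -(addNr KK) -scaleN1r; apply: linP.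
have PZ c v : P v -> P (c *: v) by move=> Pv; rewrite -[_ *: _]addr0; apply: linP.
have PD v w : P v -> P w -> P (v + w) by move=> Pv; rewrite -[v]scale1r; apply: linP.
rewrite (coord_expand s_uniq s_u); apply: (PD); last exact: PZ.
apply: big_ind => // n _; apply: big_ind => // k _.
by apply: (PD); apply: (PZ).
Qed.

(** Consequently the values of an almost inner derivation have no components along the h_k, and a
    map that factors through [coefh] kills all brackets. *)
Lemma coefh_lie k n u v : coefh k n [lie u, v] = 0.
Proof.
elim/coord_ind: u => [c u w uE wE | i p | i p |].
- by rewrite lieDl lieZl linearD linearZ /= uE wE mulr0 addr0.
- exact: coefh_lie_hmono.
- exact: coefh_lie_xmono.
- by rewrite lie_K linear0.
Qed.

Lemma even_partP u : reflect (forall k n, coefx k n u = 0) (u \in even_part).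
Proof.
apply: (iffP allP) => [u_even k n | uB n].
  rewrite /coefx mcoeff_outdom ?linear0 //; apply/negP => /u_even; apply/negP.
  by rewrite negbK; lia.
have [p [-> // | ->]] := int_parity n; first by lia.
by rewrite -mcoeff_neq0 odd_coefE big1 ?eqxx // => k _; rewrite uB scale0r.
Qed.

Lemma odd_partP u : reflect ((forall k n, coefh k n u = 0) /\ coefK u = 0) (u \in odd_part).
Proof.
apply: (iffP andP) => [[/allP u_odd /eqP uK] | [uA uK]]; split=> //.
- move=> k n; rewrite /coefh mcoeff_outdom ?linear0 //; apply/negP => /u_odd; lia.
- apply/allP => n; have [p [-> | -> _]] := int_parity n; last by lia.
  by rewrite -mcoeff_neq0 even_coefE big1 ?eqxx // => k _; rewrite uA scale0r.
- exact/eqP.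
Qed.

Lemma lie_hmono_xmono i p n : [lie hmono i p, xmono i n] = xmono i (p + n).
Proof.
apply: coord_inj => [k q | k q |].
- by rewrite coefh_lie coef_monoE.
- rewrite coefx_lie_hmono !coef_monoE (_ : (n == q - p) = (p + n == q)); last lia.
  by case: eqP; rewrite ?mul1r ?mul0r.
- rewrite coefK_lie_hmono big1 ?mulr0 // => k _; by rewrite coef_monoE mulr0.
Qed.

Lemma lie_hmono_hmono i p m n : exists c : F, [lie hmono i p, hmono m n] = c *: KK.
Proof.
exists (coefK [lie hmono i p, hmono m n]); apply: coord_inj => [k q | k q |].
- by rewrite coefh_lie linearZ /= coef_monoE mulr0.
- by rewrite coefx_lie_hmono linearZ /= !coef_monoE !mulr0.
- by rewrite linearZ /= coefK_K mulr1.
Qed.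

Lemma odd_almost_inner (D : {linear Lhat -> Lhat}) :
  almost_inner D -> odd_map D -> inner D.
Proof.
case=> D_der D_ai [D_eo D_oe].
have hmono_even i n : hmono i n \in even_part by apply/even_partP => k q; rewrite coef_monoE.
have xmono_odd i n : xmono i n \in odd_part by apply/odd_partP; split=> *; rewrite coef_monoE.
have DK : D KK = 0 by have [y ->] := D_ai KK; rewrite lie_K.
(* The value is even, and it is a bracket with x_i t^(2n+1), so it has neither an h-component nor a
   K-component. *)
have Dx i n : D (xmono i n) = 0.
  have /even_partP xB := D_oe _ (xmono_odd i n).
  have [y yE] := D_ai (xmono i n).
  apply: coord_inj => [k q|k q|]; rewrite ?xB ?linear0 // yE ?coefh_lie ?linear0 //.
  by rewrite coefK_lie_xmono.
have /= Dh i n := D_eo _ (hmono_even i n).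
have Dh_shift i k n q : coefx k q (D (hmono i n)) = (i == k)%:R * coefx k (q - n) (D (hmono i 0)).
  have [y yE] := D_ai (hmono i n).
  rewrite {1}yE coefx_lie_hmono; case: eqP => [ik | _]; rewrite ?mul0r // !mul1r.
  (* [D] kills [h_k t^(2n), h_k], a multiple of K; the x_k-coefficients of the derivation rule then
     relate D(h_k t^(2n)) to D(h_k). *)
  have [c /(congr1 D)] := lie_hmono_hmono k n k 0.
  rewrite linearZ /= DK scaler0 D_der => /(congr1 (coefx k q)); rewrite linear0.
  rewrite linearD /= lieC linearN /= !coefx_lie_hmono eqxx !mul1r subr0 => /eqP.
  by rewrite addrC subr_eq0 -ik yE coefx_lie_hmono eqxx mul1r => /eqP.
(* Only D(h_k) contributes to the x_k-component of the sum; the sign comes from [y, h_k] = -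
   [h_k, y]. *)
pose y : Lhat := - \sum_i D (hmono i 0).
have yB k q : coefx k q y = - coefx k q (D (hmono k 0)).
  rewrite /y linearN linear_sum (bigD1 k) //= big1 ?addr0 // => i /negPf ik.
  by rewrite Dh_shift ik mul0r.
have [yA yK] : (forall k q, coefh k q y = 0) /\ coefK y = 0.
  split=> [k q|]; rewrite /y linearN linear_sum /= big1 ?oppr0 // => i _.
    by have /odd_partP[->] := Dh i 0.
  by have /odd_partP[_ ->] := Dh i 0.
exists y; elim/coord_ind => [c u v uE vE | i n | i n |].
- by rewrite linearP uE vE lieDr lieZr.
- apply: coord_inj => [k q|k q|].
  + by have /odd_partP[-> _] := Dh i n; rewrite coefh_lie.
  + rewrite Dh_shift lieC linearN /= coefx_lie_hmono yB mulrN opprK.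
    by case: eqP => [-> | _]; rewrite ?mul0r.
  + have /odd_partP[_ ->] := Dh i n; rewrite lieC linearN /= coefK_lie_hmono.
    by rewrite big1 ?mulr0 ?oppr0 // => k _; rewrite yA mulr0.
- rewrite Dx lieC; apply: coord_inj => [k q|k q|]; rewrite linear0 linearN.
  + by rewrite /= coefh_lie oppr0.
  + by rewrite /= coefx_lie_xmono yA mulr0 !oppr0.
  + by rewrite /= coefK_lie_xmono oppr0.
- by rewrite DK lieC lie_K oppr0.
Qed.

(** * The maps D_ij and the even almost inner derivations *)

Variable Dij : 'I_(\dim H) * int -> {linear Lhat -> Lhat}.
Hypothesis DijP : forall i (j : int), Dij_spec h x i j (Dij (i, j)).

Lemma DijE i (j : int) u : Dij (i, j) u = coefh i j u *: KK.
Proof.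
have [DK Dx Dh] := DijP i j.
elim/coord_ind: u => [c u v uE vE | k n | k n |].
- by rewrite linearP uE vE linearP /= scalerDl scalerA.
- by rewrite Dh coef_monoE -natrM mulnb [k == i]eq_sym [n == j]eq_sym.
- by rewrite Dx coef_monoE scale0r.
- by rewrite DK coef_monoE scale0r.
Qed.

(** Both sides vanish: brackets have no h-components and K is central. *)
Lemma Dij_derivation i (j : int) : derivation (Dij (i, j)).
Proof.
move=> u v; rewrite !DijE coefh_lie scale0r lieZl lie_K.
by rewrite lieZr lieC lie_K oppr0 !scaler0 addr0.
Qed.

(** Suppose that the combination is ad y. Every D_ij kills x_k t, so y has no h-component; then ad y
    has no K-component at h_i t^(2j), where the combination has K-component c(i, j). *)
Lemma Dij_independent : independent_mod_inner Dij.
Proof.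
move=> s c s_uniq [y yE] [i j] ijs.
have yA k n : coefh k n y = 0.
  have := yE (xmono k 0); rewrite big1 => [|[i' j'] _]; last first.
    by rewrite DijE coef_monoE scale0r scaler0.
  move/(congr1 (coefx k n)); rewrite linear0 lieC linearN /= coefx_lie_xmono eqxx mul1r opprK.
  by rewrite subr0.
have := congr1 coefK (yE (hmono i j)); rewrite lieC linearN /= coefK_lie_hmono.
rewrite [X in _ * X]big1 ?mulr0 ?oppr0 => [|k _]; last by rewrite yA mulr0.
rewrite (bigD1_seq (i, j)) //= big1 => [|[i' j'] /= ij']; last first.
  rewrite DijE coef_monoE; case: (eqVneq i i') ij' => [<-|]; rewrite /= ?scale0r ?scaler0 //.
  by rewrite xpair_eqE eqxx eq_sym /= => /negPf ->; rewrite scale0r scaler0.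
by rewrite DijE coef_monoE !eqxx addr0 !linearZ /= !mulr1.
Qed.

(** First [y] is fitted so that ad y agrees with D on the x_i t^(2n+1); the sum of the D_ij then
    absorbs D - ad y. As [y] is determined only up to a multiple of the central K, its uniqueness is
    stated for the brackets with it. *)
Lemma even_almost_inner (D : {linear Lhat -> Lhat}) : almost_inner D -> even_map D ->
  exists (a : 'I_(\dim H) * int -> F) (y : Lhat),
    [/\ y \in even_part, expansion Dij a y D
      & forall a' y', y' \in even_part -> expansion Dij a' y' D ->
          a' =1 a /\ forall u, [lie y', u] = [lie y, u]].
Proof.
case=> D_der D_ai [D_ee D_oo].
have hmono_even i n : hmono i n \in even_part by apply/even_partP => k q; rewrite coef_monoE.
have xmono_odd i n : xmono i n \in odd_part by apply/odd_partP; split=> *; rewrite coef_monoE.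
have DK : D KK = 0 by have [y ->] := D_ai KK; rewrite lie_K.
have /= Dx i n := D_oo _ (xmono_odd i n).
have Dh i n : D (hmono i n) = coefK (D (hmono i n)) *: KK.
  have /even_partP hB := D_ee _ (hmono_even i n); have [y yE] := D_ai (hmono i n).
  apply: coord_inj => [k q|k q|]; rewrite linearZ /= coef_monoE ?mulr0 ?mulr1 //.
  by rewrite yE coefh_lie.
(* x_i t^(2n+1) is [h_i t^(2n), x_i t], and D(h_i t^(2n)) is central. *)
have Dx_shift i k n q : coefx k q (D (xmono i n)) = (i == k)%:R * coefx k (q - n) (D (xmono i 0)).
  have := D_der (hmono i n) (xmono i 0); rewrite lie_hmono_xmono addr0 Dh lieZl lie_K scaler0 add0r.
  by move=> ->; rewrite coefx_lie_hmono.
(* [w] packs all the D(x_i t) into one element, so that a single finite list [s] covers their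
   coordinates. *)
pose w := \sum_i D (xmono i 0).
have wB k q : coefx k q w = coefx k q (D (xmono k 0)).
  rewrite linear_sum (bigD1 k) //= big1 ?addr0 // => i /negPf ik.
  by rewrite Dx_shift ik mul0r.
have [s [s_uniq s_cov]] := finite_coord w.
pose y := \sum_(n <- s) \sum_i coefx i n w *: hmono i n.
have yA k q : coefh k q y = coefx k q (D (xmono k 0)).
  rewrite /y linear_sum; under eq_bigr => p _ do (rewrite linear_sum;
    under eq_bigr => i _ do rewrite linearZ /= coef_monoE).
  by rewrite sum_delta // -wB; case: ifPn => // /s_cov/(_ k)[].
have y_even : y \in even_part.
  apply/even_partP => k q; rewrite linear_sum big1 // => n _; rewrite linear_sum big1 // => i _.
  by rewrite linearZ /= coef_monoE mulr0.
have yx i n : [lie y, xmono i n] = D (xmono i n).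
  have /odd_partP[xA xK] := Dx i n.
  apply: coord_inj => [k q|k q|]; rewrite ?coefh_lie ?xA ?xK //.
    rewrite lieC linearN /= coefx_lie_xmono opprK yA [in RHS]Dx_shift.
    by case: eqP => [-> | _]; rewrite ?mul0r.
  by rewrite lieC linearN /= coefK_lie_xmono oppr0.
have yh z i n : z \in even_part -> [lie z, hmono i n] = coefK [lie z, hmono i n] *: KK.
  move=> /even_partP zB; apply: coord_inj => [k q|k q|];
    rewrite linearZ /= ?coefh_lie coef_monoE ?mulr0 ?mulr1 //.
  by rewrite lieC linearN /= coefx_lie_hmono zB mulr0 oppr0.
pose a (p : 'I_(\dim H) * int) := coefK (D (hmono p.1 p.2)) - coefK [lie y, hmono p.1 p.2].
exists a, y; split=> // [u | a' z z_even a'P].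
  have [t [t_uniq t_cov]] := finite_coord u.
  pose r := [seq (i, n) | n <- t, i <- enum 'I_(\dim H)].
  exists (\sum_(p <- r) a p *: Dij p u).
    exists r; split=> //.
      apply: allpairs_uniq; rewrite ?enum_uniq //.
      by move=> [n1 i1] [n2 i2] _ _ /= [-> ->].
    move=> [i n] inr; rewrite DijE (_ : coefh i n u = 0) ?scale0r ?scaler0 //.
    have /t_cov/(_ i)[] // : n \notin t; apply: contra inr => nt.
    by apply/allpairsP; exists (n, i); rewrite /= mem_enum nt.
  apply/eqP; rewrite -subr_eq; apply/eqP; rewrite big_allpairs_dep {1 2}(coord_expand t_uniq t_cov).
  have yK : [lie y, KK] = 0 by rewrite lieC lie_K oppr0.
  rewrite lieDr lieZr yK scaler0 addr0.
  rewrite linearD linearZ /= DK scaler0 addr0 linear_sum raddf_sum -sumrB; apply: eq_bigr => n _.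
  rewrite linear_sum raddf_sum -sumrB big_enum; apply: eq_bigr => i _.
  rewrite linearD /= lieDr !linearZ /= yx opprD addrACA subrr addr0.
  rewrite DijE -scalerBr Dh yh //.
  by rewrite -scalerBl !scalerA mulrC.
(* The D_ij vanish on the x_i t^(2n+1), so ad z agrees there with D, hence with ad y; this
   determines the h-coordinates of [z]. *)
have zx i n : [lie z, xmono i n] = D (xmono i n).
  have [v [? [_ _ ->]] ->] := a'P (xmono i n); rewrite big1 ?add0r // => -[i' j'] _.
  by rewrite DijE coef_monoE scale0r scaler0.
have zA k q : coefh k q z = coefh k q y.
  have := congr1 (coefx k q) (zx k 0); rewrite -yx lieC linearN /= [in RHS]lieC linearN /=.
  by rewrite !coefx_lie_xmono eqxx !mul1r !opprK subr0.
have zy : z = y + (coefK z - coefK y) *: KK.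
  move/even_partP: z_even => zB; move/even_partP: y_even => yB.
  apply: coord_inj => [k q|k q|];
    rewrite linearD linearZ /= coef_monoE ?mulr0 ?addr0 ?zA ?zB ?yB //.
  by rewrite mulr1 addrC subrK.
have ad_zy u : [lie z, u] = [lie y, u] by rewrite zy lieDl lieZl lie_K scaler0 addr0.
split=> // -[i n]; have [v [w' [w_uniq w0 vE]] DE] := a'P (hmono i n).
suff vE' : v = a' (i, n) *: KK.
  by rewrite /a /= DE vE' ad_zy linearD linearZ /= coef_monoE mulr1 addrK.
have f0 (p : 'I_(\dim H) * int) : p != (i, n) -> a' p *: Dij p (hmono i n) = 0.
  case: p => i' n'; rewrite DijE coef_monoE xpair_eqE negb_and => /orP[] /negPf.
    by rewrite eq_sym => ->; rewrite scale0r scaler0.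
  by rewrite [n' == n]eq_sym => ->; rewrite andbF scale0r scaler0.
have fE : a' (i, n) *: Dij (i, n) (hmono i n) = a' (i, n) *: KK.
  by rewrite DijE coef_monoE !eqxx scale1r.
(* The list [w'] may omit (i, n), but then that term is 0 and so is the sum. *)
rewrite vE; have [inw | inw] := boolP ((i, n) \in w').
  by rewrite (bigD1_seq (i, n)) //= big1 ?addr0.
by rewrite -fE w0 // big_seq big1 // => p pw; apply: f0; apply: contraNneq inw => <-.
Qed.

(** * Almost innerness of D_ij for nonzero j *)

Hypothesis kill_nondeg : forall (S : {pred 'I_(\dim H)}) (a : 'I_(\dim H) -> F),
  (forall k, k \notin S -> a k = 0) ->
  (forall m, m \in S -> \sum_k killing (vsval (h m)) (vsval (h k)) * a k = 0) ->
  forall k, a k = 0.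

Lemma Dij_almost_inner i (j : int) : j != 0 -> almost_inner (Dij (i, j)).
Proof.
move=> j0; split=> [|u]; first exact: Dij_derivation.
rewrite DijE; have [-> | uij] := eqVneq (coefh i j u) 0.
  by exists 0; rewrite scale0r lie0r.
have [s [s_uniq s_cov]] := finite_coord u.
pose kap m k : F := killing (vsval (h m)) (vsval (h k)).
pose S := [pred m | has (fun n => coefh m n u != 0) s].
(* The coefficients of [u] along the h_k at t^(2j) are supported in [S] and not all zero, so by
   [kill_nondeg] their pairings with the h_m, m in [S], cannot all vanish. *)
have [m /hasP[n0 n0s um] mj] : exists2 m, m \in S & \sum_k kap m k * coefh k j u != 0.
  have [/existsP[m /andP[]] | /existsPn none] :=
    boolP [exists m, (m \in S) && (\sum_k kap m k * coefh k j u != 0)]; first by exists m.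
  case/eqP: uij; apply: (@kill_nondeg S (fun k => coefh k j u)) => [k kS | m mS].
    apply/eqP; apply: contraNT kS => kj; apply/hasP; exists j => //.
    by apply: contraNT kj => /s_cov/(_ k)[->].
  by move: (none m); rewrite mS /= negbK => /eqP.
(* [f r] is the t^(2r)-coefficient of t d/dt applied to sum_k (h_m, h_k) A_k. The derivative brings
   the factor 2r, so that [f j] is nonzero only because j is. *)
pose f r := (r *+ 2)%:~R * \sum_k kap m k * coefh k r u.
have js : j \in s by apply: contraNT uij => /s_cov/(_ i)[->].
have f_neq0 : exists2 n, n \in s & f n != 0.
  by exists j; rewrite // mulf_neq0 // intr_pchar0 // mulrn_eq0.
have [N] := conv_top s_uniq f_neq0 (ex_intro2 _ (fun n => coefh m n u != 0) n0 n0s um).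
set T := \sum_(r <- s) _ => T0.
(* The choice P = t^(-2N) in y = A_m P h_m + B_m P x_m. *)
pose y := \sum_(q <- s) (coefh m q u *: hmono m (q - N) + coefx m q u *: xmono m (q - N)).
have yA k q : coefh k q y = (m == k)%:R * \sum_(r <- s) (r - N == q)%:R * coefh m r u.
  rewrite linear_sum mulr_sumr; apply: eq_bigr => r _.
  rewrite linearD !linearZ /= !coef_monoE mulr0 addr0.
  by case: eqP => _ /=; rewrite ?mul0r ?mulr0 // mul1r mulrC.
have uyK : coefK [lie u, y] = T.
  rewrite {1}(coord_expand s_uniq s_cov) lieDl lieZl lie_K scaler0 addr0.
  rewrite lie_suml linear_sum; apply: eq_bigr => r _.
  rewrite lie_suml linear_sum /=.
  under eq_bigr => k _.
    rewrite lieDl !lieZl linearD !linearZ /= coefK_lie_xmono mulr0 addr0 coefK_lie_hmono.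
    rewrite (bigD1 m) //= big1 => [|k' /negPf km]; last by rewrite yA eq_sym km mul0r mulr0.
    rewrite addr0 yA eqxx mul1r killingC -/(kap m k) mulrCA [coefh k r u * _]mulrCA !mulrA; over.
  rewrite -mulr_suml /= (_ : \sum_k _ = f r); last first.
    by rewrite /f mulr_sumr; apply: eq_bigr => k _; rewrite mulrA.
  rewrite mulr_sumr; apply: eq_bigr => q _.
  rewrite mulrCA (_ : (q - N == - r) = (r + q == N)) //; lia.
(* For k = m this is, up to sign, a coefficient of P (A_m B_m - B_m A_m); for other k every term has
   a factor 0. *)
have uyB k q : coefx k q [lie u, y] = 0.
  rewrite lieC linearN lie_suml linear_sum /=; apply/eqP; rewrite oppr_eq0; apply/eqP.
  under eq_bigr => r _ do rewrite lieDl !lieZl linearD !linearZ /= coefx_lie_hmono coefx_lie_xmono.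
  have [<- | _] := eqVneq m k; last by rewrite big1 // => r _; rewrite !mul0r oppr0 !mulr0 addr0.
  rewrite -[RHS](@conv_antisym _ s (fun n => coefh m n u) (fun n => coefx m n u) (q + N) s_uniq).
  - by apply: eq_bigr => r _; rewrite !mul1r mulrN (_ : q - (r - N) = q + N - r) //; lia.
  - by move=> n /s_cov/(_ m)[].
  - by move=> n /s_cov/(_ m)[].
exists ((coefh i j u / T) *: y); rewrite lieZr; apply: coord_inj => [k q | k q |].
- by rewrite !linearZ /= coef_monoE coefh_lie !mulr0.
- by rewrite !linearZ /= coef_monoE uyB !mulr0.
- by rewrite !linearZ /= coef_monoE uyK mulr1 divfK.
Qed.

End TwistedCoefficients.

(** * The Killing form on the adapted basis *)

Import (canonicals) passmx.

(** Positivity is used over the integers, where a vanishing sum of squares has vanishing terms. This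
    can fail over [R], so it is the nonzero determinant that is transported to [R], by
    characteristic 0. *)
Lemma gram_nondegenerate (R : fieldType) (l n : nat) (N : 'I_l -> 'I_n -> int) :
    [pchar R] =i pred0 ->
    (forall v : 'I_l -> int, (forall i, \sum_k v k * N k i = 0) -> forall k, v k = 0) ->
  forall (S : {pred 'I_l}) (a : 'I_l -> R), (forall k, k \notin S -> a k = 0) ->
    (forall m, m \in S -> \sum_k (\sum_i (N m i)%:~R * (N k i)%:~R) * a k = 0) ->
  forall k, a k = 0.
Proof.
move=> R0 N_free S a aS a_orth k.
(* The S-block of N N^T, completed by the identity: a left null vector v of G has
   v G v^T = 0, a sum of squares of integers. *)
pose G : 'M[int]_l := \matrix_(k, m)
  if (k \in S) && (m \in S) then \sum_i N m i * N k i else (k == m)%:R.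
(* Stated over any ring because it is applied both to an integer null vector and, over [R], to
   [a]. *)
have GS (Q : pzRingType) (v : 'I_l -> Q) m : (forall k, k \notin S -> v k = 0) -> m \in S ->
    \sum_k v k * (G k m)%:~R = \sum_k v k * (\sum_i N m i * N k i)%:~R.
  move=> vS mS; apply: eq_bigr => k' _; rewrite mxE mS andbT.
  by case: ifPn => // /vS ->; rewrite !mul0r.
have GnS (Q : pzRingType) (v : 'I_l -> Q) m : m \notin S -> \sum_k v k * (G k m)%:~R = v m.
  move=> mS; rewrite (bigD1 m) //= mxE (negPf mS) andbF eqxx mulr1 big1 ?addr0 // => k' /negPf km.
  by rewrite mxE (negPf mS) andbF km mulr0.
have detG : \det G != 0.
  apply/det0P => -[v /negP v0 vG]; apply: v0; apply/eqP/rowP => m; rewrite mxE.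
  have {}vG m' : \sum_k v 0 k * (G k m')%:~R = 0.
    transitivity ((v *m G) 0 m'); last by rewrite vG mxE.
    by rewrite mxE; apply: eq_bigr => k' _; rewrite intz.
  have vS k' : k' \notin S -> v 0 k' = 0 by move=> kS; rewrite -(GnS _ (v 0) k' kS).
  apply: N_free m => i; apply/eqP.
  have /psumr_eq0P sq0 : forall i : 'I_n, true -> 0 <= (\sum_k v 0 k * N k i) ^+ 2.
    by move=> i' _; apply: sqr_ge0.
  rewrite -sqrf_eq0 sq0 //.
  under eq_bigr => i' _ do rewrite expr2 mulr_suml.
  rewrite exchange_big big1 // => m _ /=.
  have [mS | /vS ->] := boolP (m \in S); last by rewrite big1 // => i' _; rewrite !mul0r.
  under eq_bigr => i' _ do rewrite -mulrA.
  rewrite -mulr_sumr (_ : \sum_i' _ = 0) ?mulr0 //.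
  rewrite -[RHS](vG m) GS //; under [LHS]eq_bigr => i' _ do rewrite mulr_sumr.
  rewrite exchange_big; apply: eq_bigr => k' _; rewrite intz mulr_sumr.
  by apply: eq_bigr => i' _; rewrite mulrCA.
have : \det (map_mx intr G : 'M[R]_l) != 0 by rewrite det_map_mx intr_pchar0.
apply: contraNeq => ak; apply/det0P; exists (\row_k a k).
  by apply: contraNneq ak => /rowP/(_ k); rewrite !mxE => ->.
apply/rowP => m; rewrite !mxE.
transitivity (\sum_k a k * (G k m)%:~R); first by apply: eq_bigr => k' _; rewrite !mxE.
have [mS | mS] := boolP (m \in S); last by rewrite GnS // aS.
rewrite GS // -[RHS](a_orth m mS); apply: eq_bigr => k' _; rewrite mulrC; congr (_ * _).
by rewrite rmorph_sum; apply: eq_bigr => i _; rewrite rmorphM.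
Qed.

(** * Simultaneous diagonalization of commuting ad-semisimple elements *)

Section CommutingFamily.
Variables (F : fieldType) (g : finLieAlgType F).
Local Notation n := (\dim {:g}).
Local Notation e := (vbasis {:g}).
Local Notation mx := (passmx.mxof e e).

Lemma lfun_tr_mxof (f : 'End(g)) : lfun_tr f = \tr (mx f).
Proof.
apply: eq_bigr => i _; rewrite !mxE /=.
by rewrite passmx.vecof_delta.
Qed.

(** The matrix of the identity map between the eigenbasis and [e] conjugates the matrix of [ad x] to
    a diagonal one. *)
Lemma ad_semisimple_diagonalizable (x : g) : ad_semisimple x -> diagonalizable (mx (ad x)).
Proof.
case=> b b_basis b_eig.
have bsz : size b == n by case/andP: b_basis => /eqP <-; rewrite eq_sym.
pose bt := Tuple bsz.
have bt_basis : basis_of {:g} bt := b_basis.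
have e_basis := vbasisP {:g}.
pose P := passmx.mxof bt e \1%VF; pose Q := passmx.mxof e bt \1%VF.
have PQ : P *m Q = 1%:M.
  by rewrite -passmx.mxof_comp // comp_lfun1l passmx.mxof1 ?(basis_free bt_basis).
have [Pu _] := mulmx1_unit PQ.
exists P => //.
have PA : P *m mx (ad x) = passmx.mxof bt bt (ad x) *m P.
  by rewrite -!passmx.mxof_comp // comp_lfun1l comp_lfun1r.
change (is_diag_mx (conjmx P (mx (ad x)))).
rewrite (_ : conjmx P _ = passmx.mxof bt bt (ad x)); last first.
  by rewrite conjumx // PA mulmxK.
apply/is_diag_mxP => i j ij; rewrite !mxE /= passmx.vecof_delta adE.
have /b_eig[c ->] : bt`_i \in b by rewrite mem_nth // (eqP bsz).
rewrite linearZ /= coord_free ?(basis_free bt_basis) //.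
by rewrite -(inj_eq val_inj) /= (negPf ij) mulr0.
Qed.

(** Commuting diagonalizable matrices are diagonalized by one invertible [P], and [d k i] is the
    eigenvalue of ad (y k) on the vector with coordinates [row i P]. The Killing form becomes the
    trace of a product of diagonal matrices, so the Gram matrix of the y_k is d d^T. *)
Lemma ad_simultaneous_eigenbasis (l : nat) (y : 'I_l -> g) :
    (forall k, ad_semisimple (y k)) -> (forall k m, [lie y k, y m] = 0) ->
  exists d : 'I_l -> 'I_n -> F,
    [/\ forall k m, killing (y k) (y m) = \sum_i d k i * d m i,
        forall i, exists2 v : g, v != 0 & forall k, [lie y k, v] = d k i *: v
      & forall c : 'I_l -> F, (forall i, \sum_k c k * d k i = 0) ->
          forall v, [lie \sum_k c k *: y k, v] = 0].
Proof.
move=> y_ss y_comm; have e_basis := vbasisP {:g}.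
pose As := [seq mx (ad (y k)) | k <- enum 'I_l].
have /codiagonalizableP[P Pu /allP PA] : {in As &, forall A B, comm_mx A B} /\
    {in As, forall A, diagonalizable A}.
  split=> [A B /mapP[k _ ->] /mapP[m _ ->] | A /mapP[k _ ->]]; last first.
    exact: ad_semisimple_diagonalizable.
  rewrite /comm_mx -!(passmx.mxof_comp _ _ e_basis); congr passmx.mxof; apply/eqP.
  by rewrite -subr_eq0 -ad_lie y_comm; apply/eqP/lfunP => v; rewrite adE lie0l lfunE.
pose D k := conjmx P (mx (ad (y k))).
pose d k i := D k i i.
have DE k : D k = diag_mx (\row_i d k i).
  have /PA /= /diag_mxP[v vE] : mx (ad (y k)) \in As by apply/map_f; rewrite mem_enum.
  rewrite /D vE; congr diag_mx; apply/rowP => i.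
  by rewrite mxE /d /D vE mxE eqxx mulr1n.
have PAk k : P *m mx (ad (y k)) = diag_mx (\row_i d k i) *m P.
  by rewrite -DE /D conjumx // mulmxKV.
exists d; split=> [k m | i | c cd].
- rewrite /killing lfun_tr_mxof (passmx.mxof_comp _ _ e_basis).
  rewrite -[mx (ad (y m))](mulKmx Pu) -[mx (ad (y k))](mulKmx Pu) !PAk.
  rewrite -!mulmxA mulKVmx // mxtrace_mulC -!mulmxA mulmxV // mulmx1.
  rewrite mulmx_diag mxtrace_diag; apply: eq_bigr => i _.
  by rewrite !mxE mulrC.
- exists (passmx.vecof e (row i P)).
    rewrite passmx.vecof_eq0 //; apply: contraTneq Pu => rP.
    rewrite -row_free_unit; apply/negP => /row_freeP[Q PQ].
    have := congr1 (row i) PQ; rewrite row_mul rP mul0mx => /rowP/(_ i).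
    by rewrite !mxE eqxx => /esym/eqP; rewrite oner_eq0.
  move=> k; rewrite -adE (passmx.hom_vecof _ e_basis) // -row_mul PAk.
  rewrite /passmx.vecof scaler_sumr; apply: eq_bigr => j _.
  by rewrite mul_diag_mx !mxE scalerA.
- have ad0 : ad (\sum_k c k *: y k) = 0.
    have adsum : ad (\sum_k c k *: y k) = \sum_k c k *: ad (y k).
      have ad0 : ad (0 : g) = 0 by apply/lfunP => v; rewrite adE lie0l lfunE.
      by elim/big_rec2: _ => // k z f _ <-; rewrite adP.
    apply/eqP; rewrite -(passmx.mxof_eq0 e_basis e_basis) adsum.
    rewrite -(mulKmx Pu (mx _)) linear_sum mulmx_sumr (_ : \sum_k _ = 0) ?mulmx0 //=.
    apply/matrixP => i j; rewrite summxE mxE.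
    under eq_bigr => k _ do rewrite linearZ /= -scalemxAr PAk mul_diag_mx !mxE mulrA.
    by rewrite -mulr_suml cd mul0r.
  by move=> v; rewrite -adE ad0 lfunE.
Qed.

End CommutingFamily.

(** Duality makes [b] free, hence a basis by its cardinality, and applying [f i] reads off the
    coordinates. *)
Lemma dual_family_expand (F : fieldType) (V : vectType F) (n : nat) (b : 'I_n -> V)
    (f : 'I_n -> 'Hom(V, F^o)) : \dim {:V} = n ->
  (forall i j, f j (b i) = (i == j)%:R) -> forall v, v = \sum_i (f i v : F) *: b i.
Proof.
move=> dimV fb v.
have [bt btE] : exists bt : n.-tuple V, forall i : 'I_n, bt`_i = b i.
  by exists [tuple b i | i < n] => i; rewrite -tnth_nth tnth_mktuple.
have f_sum (c : 'I_n -> F) i : f i (\sum_j c j *: b j) = c i.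
  rewrite linear_sum (bigD1 i) //= linearZ /= fb eqxx big1 => [|j ji].
    by rewrite addr0; exact: mulr1.
  by rewrite linearZ /= fb (negPf ji) scaler0.
have sum_bt (c : 'I_n -> F) : \sum_i c i *: bt`_i = \sum_i c i *: b i.
  by apply: eq_bigr => i _; rewrite btE.
have bt_basis : basis_of {:V} bt.
  rewrite basisEfree subvf size_tuple dimV leqnn !andbT.
  by apply/freeP => c c0 i; rewrite -(f_sum c i) -sum_bt c0 linear0.
rewrite {1}(coord_basis bt_basis (memvf v)) sum_bt; apply: eq_bigr => i _; congr (_ *: _).
by rewrite -[LHS](f_sum (fun i => coord bt i v)) -sum_bt -(coord_basis bt_basis) ?memvf.
Qed.

(** * Relations and coordinates in an adapted basis *)

Section RootData.
Variables (F : fieldType) (F0 : [pchar F] =i pred0) (g : finLieAlgType F).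
Variables (H L : {vspace g}) (torus_H : torus H).
Local Notation I := (lie_vs L L).
Variables (beta : 'I_(\dim H) -> dual H) (h : 'I_(\dim H) -> subvs_of H).
Variable x : 'I_(\dim H) -> subvs_of I.
Hypothesis basis_hx : adapted_basis beta h x.
Implicit Types (i j k m : 'I_(\dim H)) (a b : subvs_of H).

Lemma dual_basis_expand a : a = \sum_i (beta i a : F) *: h i.
Proof.
have [_ dual_h _] := basis_hx; apply: dual_family_expand; last by move=> i j; apply: dual_h.
by rewrite dimvf.
Qed.

Lemma lie_root_vector a j : [lie vsval a, vsval (x j)] = (beta j a : F) *: vsval (x j).
Proof. by have [_ _ /(_ j)[_ /weight_spaceP]] := basis_hx. Qed.

Lemma lie_basis_root i j : [lie vsval (h i), vsval (x j)] = (i == j)%:R *: vsval (x j).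
Proof. by have [_ dual_h _] := basis_hx; rewrite lie_root_vector dual_h. Qed.

(** Both elements act on each x_i by scalars, so their bracket, which is in [H], acts by 0. Hence
    every beta_i vanishes on it, and the beta_i are coordinates on [H]. *)
Lemma torus_commutative a b : [lie vsval a, vsval b] = 0.
Proof.
have [[/subvP HH _] [_ _ x_root]] := (torus_H, basis_hx).
have abH : [lie vsval a, vsval b] \in H by apply/HH/mem_lie_vs; apply: subvsP.
rewrite -(vsprojK abH) (dual_basis_expand (vsproj H _)) big1 ?linear0 // => i _.
rewrite (_ : (beta i _ : F) = 0) ?scale0r //.
have [/negPf x0 _] := x_root i; apply/eqP.
have := lie_root_vector (vsproj H [lie vsval a, vsval b]) i.
rewrite vsprojK //; move/esym; have := lieA (vsval a) (vsval b) (vsval (x i)).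
rewrite !lie_root_vector !linearZ /= !lie_root_vector !scalerA mulrC => /eqP.
rewrite -subr_eq subrr => /eqP <- /eqP; rewrite scaler_eq0 x0 orbF //.
Qed.

(** The sum of the h_i serves as a grading element in the eigenvalue comparisons that follow. *)
Lemma lie_sum_root j : [lie vsval (\sum_i h i), vsval (x j)] = vsval (x j).
Proof.
have [_ dual_h _] := basis_hx; rewrite lie_root_vector linear_sum /= (bigD1 j) //=.
by rewrite dual_h eqxx big1 ?addr0 ?scale1r // => i /negPf ij; rewrite dual_h ij.
Qed.

Let two_neq0 : 2 != 0 :> F.
Proof. by rewrite ((pcharf0P F).1 F0 2). Qed.

(** The grading element acts on the bracket by 1 + 1 = 2, but also by 0, since the bracket lies in
    the commutative [H]. *)
Lemma lie_root_root (HI : twistable H I) i j : [lie vsval (x i), vsval (x j)] = 0.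
Proof.
have [_ _ /subvP II] := HI.
have yH : [lie vsval (x i), vsval (x j)] \in H by apply/II/mem_lie_vs; apply: subvsP.
have := lieA (vsval (\sum_i h i)) (vsval (x i)) (vsval (x j)).
rewrite !lie_sum_root -{1}(vsprojK yH) torus_commutative => /esym/eqP.
by rewrite -mulr2n -scaler_nat scaler_eq0 (negPf two_neq0) => /eqP.
Qed.

(** Moving the grading element across the invariant form shows that the pairing equals its
    opposite. *)
Lemma killing_root_root i j : killing (vsval (x i)) (vsval (x j)) = 0.
Proof.
have := killing_lie (vsval (x i)) (vsval (\sum_i h i)) (vsval (x j)).
rewrite lie_sum_root lieC lie_sum_root killingC linearN /= killingC => /eqP.
rewrite eq_sym -addr_eq0 -mulr2n -mulr_natl mulf_eq0 (negPf two_neq0) => /eqP //.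
Qed.

(** By [Qgraded_by] the beta_i span the root lattice over the integers, and they take the values 0
    and 1 on the h_k. *)
Lemma root_values_integral (a : dual H) : in_Zspan (@Defs.roots _ g H) a ->
  forall k, exists z : int, (a (h k) : F) = z%:~R.
Proof.
have [[_ _ _ spanE _] dual_h _] := basis_hx => /spanE [s [c [s_beta ->]]] k.
elim: s s_beta => [|b s IHs] s_beta; first by exists 0; rewrite big_nil lfunE.
have [|z zE] := IHs; first by move=> w ws; apply: s_beta; rewrite inE ws orbT.
have /codomP[i bE] : b \in codom beta by apply: s_beta; rewrite mem_head.
exists (c b * (k == i)%:R + z); rewrite big_cons add_lfunE zE intrD intrM; congr (_ + _).
by rewrite -scaler_int scale_lfunE bE dual_h; case: (k == i).
Qed.

(** [gram_nondegenerate] applies to the eigenvalues of the h_k on a common eigenbasis of [g]: each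
    eigenvector has weight 0 or a root, so these eigenvalues are integers. *)
Lemma killing_nondegenerate :
  forall (S : {pred 'I_(\dim H)}) (a : 'I_(\dim H) -> F), (forall k, k \notin S -> a k = 0) ->
  (forall m, m \in S -> \sum_k killing (vsval (h m)) (vsval (h k)) * a k = 0) ->
  forall k, a k = 0.
Proof.
have [_ dual_h x_root] := basis_hx.
have [d [killE d_eig d_ker]] := @ad_simultaneous_eigenbasis _ g _ (fun k => vsval (h k))
  (fun k => torus_H.2 _ (subvsP _)) (fun k m => torus_commutative _ _).
have [N NE] : exists N : 'I_(\dim H) -> 'I_(\dim {:g}) -> int,
    forall k (p : 'I_(\dim {:g})), d k p = (N k p)%:~R.
  have dz k (p : 'I_(\dim {:g})) : exists z : int, d k p = z%:~R.
    have [v v0 vE] := d_eig p.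
    (* The weight of [v], rebuilt by duality from the eigenvalues of the h_m. *)
    pose w : dual H := \sum_m d m p *: beta m.
    have wE m : w (h m) = d m p :> F.
      rewrite sum_lfunE (bigD1 m) //= scale_lfunE dual_h eqxx big1 => [|m' /negPf mm].
        by rewrite addr0; exact: mulr1.
      by rewrite scale_lfunE dual_h eq_sym mm scaler0.
    have v_weight : v \in weight_space w.
      apply/weight_spaceP => a; rewrite (dual_basis_expand a) !linear_sum /= scaler_suml.
      elim/big_rec2: _ => [|m z y _ yz]; first by rewrite lie0l.
      by rewrite lieDl yz lieZl vE scalerA [w _]linearZ -wE.
    rewrite -wE; apply: root_values_integral.
    have [-> | w0] := eqVneq w 0; first by exists [::], (fun=> 0); rewrite big_nil.
    exists [:: w], (fun=> 1); rewrite big_seq1; split=> // w'; rewrite inE => /eqP ->.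
    by rewrite inE w0; apply: contraNneq v0 => w_eq0; rewrite -memv0 -w_eq0.
  have [N NE] := fin_all_exists (fun k => fin_all_exists (dz k)).
  by exists N.
move=> S a aS a_orth; apply: (gram_nondegenerate F0 _ aS) => [v Nv j | m mS].
  (* Full row rank: an integral combination of the h_k with all eigenvalues 0 kills x_j, on which it
     acts by its j-th coefficient. *)
  pose c k : F := (v k)%:~R.
  have c_ker p : \sum_k c k * d k p = 0.
    rewrite -[RHS](mulr0z 1) -(Nv p) rmorph_sum; apply: eq_bigr => k _.
    by rewrite NE -intrM.
  have [/negPf x0 _] := x_root j.
  have := d_ker c c_ker (vsval (x j)).
  rewrite (_ : \sum_k _ = vsval (\sum_k c k *: h k)); last first.
    by rewrite linear_sum; apply: eq_bigr => k _; rewrite linearZ.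
  rewrite lie_root_vector linear_sum (bigD1 j) //= linearZ /= dual_h eqxx.
  rewrite big1 ?addr0 => [|k /negPf kj]; last by rewrite linearZ /= dual_h kj scaler0.
  move/eqP; rewrite scaler_eq0 x0 orbF => /eqP cj; apply: contraTeq isT => vj.
  by have := intr_pchar0 F0 vj; rewrite -[_%:~R]mulr1 [_ * 1]cj eqxx.
rewrite -[RHS](a_orth m mS); apply: eq_bigr => k _; rewrite killE; congr (_ * _).
by apply: eq_bigr => p _; rewrite !NE.
Qed.

Hypothesis dim_L : \dim L = (2 * \dim I)%N.

(** L is the sum of H and of the root spaces W_i, which lie in I, so [dim_L] gives dim I <= dim H.
    As the x_i are free, they form a basis of I, and the gam_i are its coordinate functions. *)
Lemma root_coordinates : exists gam : 'I_(\dim H) -> dual I,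
  (forall i j, gam j (x i) = (i == j)%:R) /\ forall z : subvs_of I, z = \sum_i (gam i z : F) *: x i.
Proof.
have [[_ /subvP HL _ _ [defL dirL]] dual_h x_root] := basis_hx.
pose W i := weight_space (beta i).
have WI : (\sum_i W i <= I)%VS.
  (* h_i acts as the identity on W_i, so each w in W_i is the bracket [h_i, w] of elements of
     [L]. *)
  apply/subv_sumP => i _; apply/subvP => w /[dup] wW /weight_spaceP/(_ (h i)).
  rewrite dual_h eqxx scale1r => <-; apply: mem_lie_vs; first by apply/HL/subvsP.
  rewrite defL; apply: subvP wW; apply: subv_trans (addvSr _ _).
  by rewrite /codom /image_mem big_map big_enum /=; apply: (sumv_sup i).
have [xt xtE] : exists xt : (\dim H).-tuple (subvs_of I), forall i, xt`_i = x i.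
  by exists [tuple x i | i < \dim H] => i; rewrite -tnth_nth tnth_mktuple.
have xt_free : free xt.
  apply/freeP => c c0 i.
  have [/negPf x0 _] := x_root i.
  (* Bracketing a linear relation with h_i isolates its i-th term. *)
  have /(congr1 (fun y => [lie vsval (h i), vsval y])) := c0.
  rewrite !linear0 linear_sum raddf_sum (bigD1 i) //= big1 => [|j /negPf ji].
    rewrite addr0 xtE lieZr lie_basis_root eqxx scale1r => /eqP.
    by rewrite scaler_eq0 x0 orbF => /eqP.
  by rewrite xtE lieZr lie_basis_root eq_sym ji scale0r scaler0.
have dimI : \dim I = \dim H.
  apply/eqP; rewrite eqn_leq; apply/andP; split.
    rewrite -(leq_add2r (\dim I)) addnn -mul2n -dim_L {1}defL.
    apply: leq_trans (dimv_add_leqif _ _) _; rewrite leq_add2l dimvS //.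
    by rewrite /codom /image_mem big_map big_enum.
  move: xt_free; rewrite /free size_tuple => /eqP <-.
  by rewrite (leq_trans (dimvS (subvf _))) // dimvf.
have xt_basis : basis_of {:subvs_of I} xt.
  have dimI' : \dim {:subvs_of I} = \dim I by rewrite dimvf.
  by rewrite basisEfree subvf xt_free size_tuple dimI' dimI leqnn.
exists (fun i => linfun (coord xt i : subvs_of I -> F^o)); split=> [i j | z].
  by rewrite lfunE /= -xtE coord_free.
rewrite {1}(coord_basis xt_basis (memvf z)); apply: eq_bigr => i _.
by rewrite xtE lfunE.
Qed.

End RootData.

(* For almost-innerness of D_ij the case j = 0 is excluded: see
   Defs.Di0_not_almost_inner. *)
Theorem theorem4p3 (F : closedFieldType) (F0 : [pchar F] =i pred0)
    (g : finLieAlgType F) (ss_g : semisimple g)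
    (H : {vspace g}) (max_H : maximal_torus H)
    (L : {vspace g}) (min_L : minimal_Qgraded H L)
    (dim_L : \dim L = (2 * \dim (lie_vs L L))%N)
    (beta : 'I_(\dim H) -> dual H) (h : 'I_(\dim H) -> subvs_of H)
    (x : 'I_(\dim H) -> subvs_of (lie_vs L L)) (basis_hx : adapted_basis beta h x) :
  let Lhat := twisted (adapted_twistable F0 max_H.1 basis_hx) in
  forall (Dij : 'I_(\dim H) * int -> {linear Lhat -> Lhat})
    (DijP : forall i j, Dij_spec h x i j (Dij (i, j))),
  [/\ (forall i j, derivation (Dij (i, j))) /\
      (forall i (j : int), j != 0 -> almost_inner (Dij (i, j))),
      forall D : {linear Lhat -> Lhat}, almost_inner D -> odd_map D -> inner D,
      forall D : {linear Lhat -> Lhat}, almost_inner D -> even_map D ->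
        exists (a : 'I_(\dim H) * int -> F) (y : Lhat),
          [/\ y \in even_part, expansion Dij a y D
            & forall a' y', y' \in even_part -> expansion Dij a' y' D ->
                a' =1 a /\ forall u, [lie y', u] = [lie y, u]]
    & independent_mod_inner Dij].
Proof.
set HI := adapted_twistable F0 max_H.1 basis_hx => Lhat Dij DijP.
have torus_H := max_H.1; have [_ dual_h _] := basis_hx.
have [gam [dual_x x_gen]] := root_coordinates basis_hx dim_L.
have h_gen := dual_basis_expand basis_hx.
have lie_hh i j : [lie vsval (h i), vsval (h j)] = 0 := torus_commutative torus_H basis_hx _ _.
have lie_hx := lie_basis_root basis_hx.
have lie_xx := lie_root_root F0 torus_H basis_hx HI.
have kill_xx := killing_root_root F0 basis_hx.
have kill_nondeg := killing_nondegenerate F0 torus_H basis_hx.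
split; first split.
- move=> i j; exact: (Dij_derivation dual_h dual_x h_gen x_gen lie_hh lie_xx DijP i j).
- move=> i j j0.
  exact: (Dij_almost_inner F0 dual_h dual_x h_gen x_gen lie_hh lie_hx lie_xx
    kill_xx DijP kill_nondeg i j0).
- exact: odd_almost_inner dual_h dual_x h_gen x_gen lie_hh lie_hx lie_xx kill_xx.
- move=> D; exact: (even_almost_inner dual_h dual_x h_gen x_gen lie_hh lie_hx lie_xx kill_xx DijP).
- exact: (Dij_independent dual_h dual_x h_gen x_gen lie_hx DijP).
Qed.
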